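(* Let $\alpha,\beta\in\mathbb{C}$ and $p\in\mathbb{C}^*$. Any finite non-trivial irreducible conformal module $V$ over $\mathfrak{B}(\alpha,\beta,p)$ is free of rank one as a $\mathbb{C}[\partial]$-module.
   Context: All vector spaces are over $\mathbb{C}$; $\mathbb{C}^*=\mathbb{C}\setminus\{0\}$, $\mathbb{Z}_+=\{0,1,2,\dots\}$. A Lie conformal algebra is a $\mathbb{C}[\partial]$-module $R$ with a linear map $R\otimes R\to R[\lambda]=\mathbb{C}[\lambda]\otimes R$, $a\otimes b\mapsto[a\,{}_\lambda\,b]$, such that $[\partial a\,{}_\lambda\,b]=-\lambda[a\,{}_\lambda\,b]$, $[a\,{}_\lambda\,\partial b]=(\partial+\lambda)[a\,{}_\lambda\,b]$, $[a\,{}_\lambda\,b]=-[b\,{}_{-\lambda-\partial}\,a]$, and $[a\,{}_\lambda[b\,{}_\mu\,c]]=[[a\,{}_\lambda\,b]\,{}_{\lambda+\mu}\,c]+[b\,{}_\mu[a\,{}_\lambda\,c]]$. A conformal module over $R$ is a $\mathbb{C}[\partial]$-module $M$ with a linear map $R\otimes M\to M[\lambda]$, $a\otimes v\mapsto a\,{}_\lambda\,v$, such that $(\partial a)\,{}_\lambda\,v=-\lambda\, a\,{}_\lambda\,v$, $a\,{}_\lambda(\partial v)=(\partial+\lambda)\,a\,{}_\lambda\,v$, $a\,{}_\lambda(b\,{}_\mu\,v)-b\,{}_\mu(a\,{}_\lambda\,v)=[a\,{}_\lambda\,b]\,{}_{\lambda+\mu}\,v$. It is finite if finitely generated over $\mathbb{C}[\partial]$,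 non-trivial if the $\lambda$-action is not identically zero, and irreducible if it is nonzero and has no submodules other than $0$ and itself. For $\alpha,\beta\in\mathbb{C}$, $p\in\mathbb{C}^*$, $\mathfrak{B}(\alpha,\beta,p)$ is the Lie conformal algebra that is free over $\mathbb{C}[\partial]$ with basis $\{L_i,W_i\mid i\in\mathbb{Z}_+\}$ and $\lambda$-brackets $[L_i\,{}_\lambda\,L_j]=\big((i+p)\partial+(i+j+2p)\lambda\big)L_{i+j}$, $[L_i\,{}_\lambda\,W_j]=\big((i+p)(\partial+\beta)+(i+j+\alpha)\lambda\big)W_{i+j}$, $[W_i\,{}_\lambda\,W_j]=0$ (with $[W_j\,{}_\lambda\,L_i]$ given by skew-symmetry). *)

(* Defs.v *)
From HB Require Import structures.
From mathcomp Require Import all_boot all_order all_algebra.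
From mathcomp Require Import complex.
From mathcomp Require Import reals.

Set Implicit Arguments.
Unset Strict Implicit.
Unset Printing Implicit Defensive.

Import GRing.Theory.
Local Open Scope ring_scope.

(* A K[∂]-module is an lmodType over {poly K}: ∂ acts as 'X *: _ and a scalar
   c of K as c%:P *: _ .                                                     *)

Section Modules.
Variables (A : comNzRingType) (M : lmodType A).

Definition spanning (I : eqType) (e : I -> M) : Prop :=
  forall v : M, exists (s : seq I) (f : I -> A), v = \sum_(i <- s) f i *: e i.

Definition lin_independent (I : eqType) (e : I -> M) : Prop :=
  forall (s : seq I) (f : I -> A), uniq s ->
    \sum_(i <- s) f i *: e i = 0 -> forall i, i \in s -> f i = 0.

Definition is_basis (I : eqType) (e : I -> M) : Prop :=
  spanning e /\ lin_independent e.

Definition finitely_generated : Prop :=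
  exists (n : nat) (e : 'I_n -> M), spanning e.

Definition free_of_rank (n : nat) : Prop :=
  exists e : 'I_n -> M, is_basis e.

(* An element sum_n λ^n u_n of M[λ] is represented by its coefficient
   sequence u : nat -> M, subject to [lpoly u].                              *)
Definition lpoly (u : nat -> M) : Prop :=
  exists N, forall n, (N <= n)%N -> u n = 0.

(* λ * u *)
Definition lshift (u : nat -> M) (n : nat) : M :=
  if n is k.+1 then u k else 0.

End Modules.

Section Conformal.
Variable K : fieldType.

(* [br a b n] is the coefficient of λ^n in [a_λ b].
   - [br_skew]: -[b_{-λ-∂} a] = - sum_k (-1)^k (λ+∂)^k (br b a k), whose
     coefficient of λ^n is - sum_k (-1)^k C(k,n) ∂^(k-n) (br b a k); N is any
     bound on the degree in λ of [b_λ a].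
   - [br_jacobi] compares the coefficients of λ^m μ^n; that of
     [[a_λ b]_{λ+μ} c] = sum_k λ^k sum_l (λ+μ)^l (br (br a b k) c l) comes
     from the terms with k <= m and l = (m - k) + n.                         *)
Record lie_conformal_algebra := LieConformalAlgebra {
  lca_sort :> lmodType {poly K};
  br : lca_sort -> lca_sort -> nat -> lca_sort;
  br_lpoly : forall a b, lpoly (br a b);
  br_linearl : forall (c : K) a a' b n,
    br (c%:P *: a + a') b n = c%:P *: br a b n + br a' b n;
  br_linearr : forall (c : K) a b b' n,
    br a (c%:P *: b + b') n = c%:P *: br a b n + br a b' n;
  br_derivl : forall a b n, br ('X *: a) b n = - lshift (br a b) n;
  br_derivr : forall a b n,
    br a ('X *: b) n = 'X *: br a b n + lshift (br a b) n;
  br_skew : forall a b N, (forall k, (N <= k)%N -> br b a k = 0) ->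
    forall n, br a b n =
      - \sum_(k < N) (-1) ^+ k *: ('X^(k - n) *: br b a k *+ 'C(k, n));
  br_jacobi : forall a b c m n,
    br a (br b c n) m =
      \sum_(k < m.+1) br (br a b k) c (m - k + n) *+ 'C(m - k + n, n)
      + br b (br a c m) n
}.

(* [act a v n] is the coefficient of λ^n in a_λ v. *)
Record conformal_module (B : lie_conformal_algebra) := ConformalModule {
  cmod_sort :> lmodType {poly K};
  act : B -> cmod_sort -> nat -> cmod_sort;
  act_lpoly : forall a v, lpoly (act a v);
  act_linearl : forall (c : K) a a' v n,
    act (c%:P *: a + a') v n = c%:P *: act a v n + act a' v n;
  act_linearr : forall (c : K) a v v' n,
    act a (c%:P *: v + v') n = c%:P *: act a v n + act a v' n;
  act_derivl : forall a v n, act ('X *: a) v n = - lshift (act a v) n;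
  act_derivr : forall a v n,
    act a ('X *: v) n = 'X *: act a v n + lshift (act a v) n;
  act_jacobi : forall a b v m n,
    act a (act b v n) m - act b (act a v m) n =
      \sum_(k < m.+1) act (br a b k) v (m - k + n) *+ 'C(m - k + n, n)
}.

Definition submodule (B : lie_conformal_algebra) (V : conformal_module B)
    (N : V -> Prop) : Prop :=
  [/\ N 0,
      forall (f : {poly K}) (u v : V), N u -> N v -> N (f *: u + v)
    & forall (a : B) (v : V) (n : nat), N v -> N (act a v n)].

Definition nontrivial_module (B : lie_conformal_algebra)
    (V : conformal_module B) : Prop :=
  exists (a : B) (v : V) (n : nat), act a v n <> 0.

Definition irreducible_module (B : lie_conformal_algebra)
    (V : conformal_module B) : Prop :=
  (exists v : V, v <> 0) /\
  forall N : V -> Prop, submodule N ->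
    (forall v, N v -> v = 0) \/ (forall v, N v).

Definition finite_module (B : lie_conformal_algebra)
    (V : conformal_module B) : Prop :=
  finitely_generated V.

Definition LW_family (B : lie_conformal_algebra) (L W : nat -> B)
    (x : nat + nat) : B :=
  match x with inl i => L i | inr i => W i end.

(* B, with the families L and W, is 𝔅(α, β, p). A λ-bracket of degree at most
   one is given by its coefficients of λ^0 and λ^1; the bracket [W_j λ L_i] is
   determined by [br_skew].                                                  *)
Definition is_Balpha_beta_p (alpha beta p : K) (B : lie_conformal_algebra)
    (L W : nat -> B) : Prop :=
  [/\ is_basis (LW_family L W),
      forall i j n, br (L i) (L j) n =
        nth 0 [:: ((i%:R + p)%:P * 'X) *: L (i + j)%N;
                  (i%:R + j%:R + p *+ 2)%:P *: L (i + j)%N] n,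
      forall i j n, br (L i) (W j) n =
        nth 0 [:: ((i%:R + p)%:P * ('X + beta%:P)) *: W (i + j)%N;
                  (i%:R + j%:R + alpha)%:P *: W (i + j)%N] n
    & forall i j n, br (W i) (W j) n = 0].

End Conformal.

(* Main.v *)
(** Write X(n) for n! times the coefficient of λ^n in X_λ, acting on V, and let
    y = L_0(0).  Torsion acts trivially, so V is torsion free over C[∂], and by
    Cayley-Hamilton every operator commuting with ∂ is integral over C[∂].

    The operator T = p∂ - y commutes with ∂ and with the L_i, and W shifts its
    eigenvalues by -pβ; this kills W when β <> 0, and then Schur's lemma makes T
    a scalar, so that V is a module over C[y].  From there everything rests on
    operators that commute with y and are eigenvectors of ad L_0(1): an integral
    relation over C[y] satisfied by such an operator is homogeneous, hence the
    operator is nilpotent if its weight is -kp with k > 0, and algebraic over C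
    if its weight is 0.  The coefficients of L_0(λ) L_0(-λ) are of this kind.
    Those of negative weight produce a vector killed by all L_0(m), m >= 2; that
    of weight 0 makes it an eigenvector of L_0(1); and the coefficient of λ^4,
    being nilpotent, forces L_i and W_i to vanish for large i.  The last
    nonzero L_k or W_k spans an abelian ideal; its kernel is a submodule, and a
    commutator computation leaves only W_0 and (for p = -1) L_1, with scalar
    zero mode.  A vector singular for these as well generates a submodule
    C[∂]v, which must be V. *)

Require Import Defs.
From HB Require Import structures.
From mathcomp Require Import all_boot all_order all_algebra.
From mathcomp Require Import complex.
From mathcomp Require Import reals.
From mathcomp Require Import boolp polyXY ring zify.

Set Implicit Arguments.
Unset Strict Implicit.
Unset Printing Implicit Defensive.

Import Order.TTheory GRing.Theory Num.Theory.
Local Open Scope ring_scope.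

(** * Commutators and nilpotency *)

Definition comr (A : pzRingType) (a b : A) : A := a * b - b * a.

Section Commutators.
Variables (K : fieldType) (A : algType K).
Implicit Types a b c D T : A.

Lemma comr_is_linear a : linear (comr a).
Proof.
move=> k u v; rewrite /comr mulrDr mulrDl -scalerAl -scalerAr opprD addrACA.
by rewrite -scalerBr.
Qed.

HB.instance Definition _ a := GRing.isLinear.Build K A A _ (comr a) (comr_is_linear a).

Lemma comrC a b : comr a b = - comr b a.
Proof. by rewrite opprB. Qed.

Lemma comrMr a b c : comr a (b * c) = comr a b * c + b * comr a c.
Proof. by rewrite /comr mulrBl mulrBr !mulrA addrA subrK. Qed.

Lemma comr_comm a b : GRing.comm a b -> comr a b = 0.
Proof. by rewrite /comr => ->; rewrite subrr. Qed.

Lemma comm_comr a b : comr a b = 0 -> GRing.comm a b.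
Proof. by move/eqP; rewrite subr_eq0 => /eqP. Qed.

Lemma mulr_comr a b : a * b = b * a + comr a b.
Proof. by rewrite addrC subrK. Qed.

Lemma comr_eigenM D a b s t : comr D a = s *: a -> comr D b = t *: b ->
  comr D (a * b) = (s + t) *: (a * b).
Proof. by move=> ha hb; rewrite comrMr ha hb -scalerAl -scalerAr scalerDl. Qed.

Lemma comr_eigenX D a s n : comr D a = s *: a ->
  comr D (a ^+ n) = (n%:R * s) *: a ^+ n.
Proof.
move=> h; elim: n => [|n IH]; first by rewrite expr0 mul0r scale0r /comr mulr1 mul1r subrr.
by rewrite exprS (comr_eigenM h IH) -nat1r mulrDl mul1r.
Qed.

(** Distinct eigenspaces of ad D are independent: the product of the operators ad D - z over the
    weights z other than w0 annihilates the other terms and scales those of weight w0 by a nonzero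
    constant. *)
Lemma comr_eigen_sum D (I : eqType) (r : seq I) (o : I -> A) (w : I -> K) (w0 : K) :
  (forall i, comr D (o i) = w i *: o i) -> \sum_(i <- r) o i = 0 ->
  \sum_(i <- r | w i == w0) o i = 0.
Proof.
move=> ho hs.
have key : forall ws : seq K, \sum_(i <- r) (\prod_(z <- ws) (w i - z)) *: o i = 0.
  elim=> [|z ws IH]; first by rewrite -[RHS]hs; apply: eq_bigr => i _; rewrite big_nil scale1r.
  have h1 : comr D (\sum_(i <- r) (\prod_(z <- ws) (w i - z)) *: o i) = 0 by rewrite IH linear0.
  have h2 : z *: (\sum_(i <- r) (\prod_(z <- ws) (w i - z)) *: o i) = 0 by rewrite IH scaler0.
  rewrite linear_sum in h1; rewrite scaler_sumr in h2.
  rewrite -[RHS](subrr 0) -[X in _ = X - _]h1 -[X in _ = _ - X]h2 -sumrB.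
  apply: eq_bigr => i _.
  by rewrite linearZ /= ho big_cons !scalerA -scalerBl; congr (_ *: _); ring.
pose ws := [seq z <- map w r | z != w0].
have hz : \prod_(z <- ws) (w0 - z) != 0.
  rewrite prodf_seq_neq0; apply/allP => z /=; rewrite mem_filter => /andP[h _].
  by rewrite subr_eq0 eq_sym.
apply: (scalerI hz); rewrite scaler0 scaler_sumr -[RHS](key ws).
rewrite [RHS](bigID (fun i => w i == w0)) /= [X in _ = _ + X]big1_seq ?addr0.
  by apply: eq_bigr => i /eqP ->.
move=> i /andP[hi ir]; rewrite (_ : \prod_(_ <- _) _ = 0) ?scale0r //.
apply/eqP; rewrite prodf_seq_eq0; apply/hasP; exists (w i); last by rewrite /= subrr.
by rewrite mem_filter hi map_f.
Qed.


Lemma horner_alg_comm a b (r : {poly K}) :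
  GRing.comm b a -> GRing.comm b (horner_alg a r).
Proof.
move=> ba; elim/poly_ind: r => [|r c IH]; first by rewrite rmorph0; exact: commr0.
rewrite rmorphD rmorphM /= horner_algX horner_algC; apply: commrD; first exact: commrM.
by rewrite /GRing.comm mulr_algr mulr_algl.
Qed.

Lemma horner_map_comm a b c (Q : {poly {poly K}}) : GRing.comm c a -> GRing.comm c b ->
  GRing.comm c (map_poly (horner_alg a) Q).[b].
Proof.
move=> ca cb; elim/poly_ind: Q => [|Q r IH].
  by rewrite rmorph0 horner0; exact: commr0.
rewrite rmorphD rmorphM /= map_polyX map_polyC hornerMXaddC.
by apply: commrD; [exact: commrM | exact: horner_alg_comm].
Qed.

(* A relation P(x, T) = 0, with [D, x] = y and [D, T] = 0, differentiates to
   y P_x(x, T) = 0. *)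
Lemma comr_horner_deriv D x T y (Q : {poly {poly K}}) :
  comr D T = 0 -> comr D x = y -> GRing.comm y x -> GRing.comm y T ->
  comr D (map_poly (horner_alg T) Q).[x] =
  y * (map_poly (horner_alg T) Q^`()).[x].
Proof.
move=> hT hx yx yT.
have DT (r : {poly K}) : comr D (horner_alg T r) = 0.
  elim/poly_ind: r => [|r c IH]; first by rewrite rmorph0 linear0.
  rewrite rmorphD rmorphM /= horner_algX horner_algC linearD /= comrMr IH hT.
  by rewrite mul0r mulr0 !add0r linearZ /= /comr mulr1 mul1r subrr scaler0.
elim/poly_ind: Q => [|Q c IH]; first by rewrite rmorph0 deriv0 rmorph0 horner0 linear0 mulr0.
rewrite !(rmorphD, rmorphM, derivD, derivM, derivX, derivC) /= map_polyX map_polyC.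
rewrite hornerMXaddC rmorph1 rmorph0 addr0 mulr1.
rewrite hornerD hornerMX linearD /= comrMr DT addr0 IH hx mulrDr mulrA.
by rewrite (horner_map_comm Q yT yx).
Qed.

End Commutators.

(** * Differentiation of polynomial relations between operators *)

Section ConstantRelations.
Variables (K : numClosedFieldType) (A : algType K).
Implicit Types a b c D T : A.

(** Turns a relation for T over C[x] into a polynomial in x over C[T], which ad D differentiates
    formally. *)
Lemma horner_swapXY x T (P : {poly {poly K}}) : GRing.comm T x ->
  (map_poly (horner_alg T) (swapXY P)).[x] = (map_poly (horner_alg x) P).[T].
Proof.
move=> Tx; elim/poly_ind: P => [|P c IH]; first by rewrite !rmorph0 !horner0.
rewrite !(rmorphD, rmorphM) /= swapXY_X swapXY_polyC !map_polyX !map_polyC /= horner_algX.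
rewrite !hornerD hornerMX hornerC -IH; congr (_ + _).
  by rewrite hornerM_comm ?hornerC //; rewrite /comm_poly hornerC.
elim/poly_ind: c => [|c k IHc]; first by rewrite !rmorph0 horner0.
rewrite !(rmorphD, rmorphM) /= ?map_polyX ?map_polyC /= ?map_polyX ?map_polyC /=.
by rewrite hornerMXaddC !horner_algX !horner_algC IHc.
Qed.

(** Since ad D scales y, it turns y^e Q(x, T) = 0 into y^(e+1) Q_x(x, T) = 0. Iteration lowers the
    degree in x until only a polynomial in T is left. *)
Lemma comr_relation D x T y k (P : {poly {poly K}}) :
  comr D T = 0 -> comr D x = y -> comr D y = k *: y ->
  GRing.comm y x -> GRing.comm y T -> GRing.comm T x ->
  P != 0 -> (map_poly (horner_alg x) P).[T] = 0 ->
  exists e (r : {poly K}), r != 0 /\ y ^+ e * horner_alg T r = 0.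
Proof.
move=> hT hx hy yx yT Tx P0; rewrite -horner_swapXY // => hP.
pose ev Q := (map_poly (horner_alg T) Q).[x].
have : exists e, exists2 Q : {poly {poly K}}, Q != 0 & y ^+ e * ev Q = 0.
  by exists 0%N, (swapXY P); rewrite ?swapXY_eq0 // expr0 mul1r.
case=> e [Q]; have [n] := ubnP (size Q); elim: n Q e => // n IHn Q e leQ Q0 hQ.
have [Q1|Q1] := leqP (size Q) 1.
  have /size_poly1P : size Q == 1 by rewrite eqn_leq Q1 lt0n size_poly_eq0.
  case=> r r0 eQ; exists e, r; split => //; move: hQ.
  by rewrite /ev eQ map_polyC hornerC.
apply: (IHn Q^`() e.+1).
- exact: leq_trans (lt_size_deriv Q0) _.
- apply: contraTneq Q1 => Q'0; rewrite -leqNgt; apply/leq_sizeP => -[//|i] _.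
  have /eqP := congr1 (fun q : {poly {poly K}} => q`_i) Q'0.
  rewrite coef_deriv coef0 -scaler_nat scaler_eq0 pnatr_eq0 /=.
  by move/eqP.
have h0 : comr D (y ^+ e * ev Q) = 0 by rewrite hQ linear0.
move: h0; rewrite comrMr (comr_eigenX _ hy) -scalerAl hQ scaler0 add0r.
by rewrite (comr_horner_deriv _ hT hx) // exprSr mulrA.
Qed.

End ConstantRelations.

Definition nilpotent (A : pzRingType) (a : A) : Prop := exists n, a ^+ n = 0.

Section Nilpotent.
Variables (K : numClosedFieldType) (A : algType K).
Implicit Types a b c D T : A.

Lemma horner_algE a (r : {poly K}) :
  horner_alg a r = \sum_(i < size r) r`_i *: a ^+ i.
Proof.
rewrite -{1}[r]coefK poly_def rmorph_sum; apply: eq_bigr => i _.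
by rewrite -mul_polyC rmorphM rmorphXn /= horner_algX horner_algC mulr_algl.
Qed.

(** The powers of a have distinct weights i s, so the relation splits into monomials, and the
    leading one must vanish. *)
Lemma eigen_relation_nilpotent D a s (r : {poly K}) :
  comr D a = s *: a -> s != 0 -> r != 0 -> horner_alg a r = 0 -> nilpotent a.
Proof.
move=> ha s0 r0; rewrite horner_algE => hr; exists (size r).-1.
have sr : ((size r).-1 < size r)%N by rewrite prednK // lt0n size_poly_eq0.
pose o (i : 'I_(size r)) := r`_i *: a ^+ i.
have ho i : comr D (o i) = (i%:R * s) *: o i.
  by rewrite linearZ /= (comr_eigenX _ ha) !scalerA mulrC.
have := comr_eigen_sum ((size r).-1%:R * s) ho hr.
rewrite (eq_bigl (pred1 (Ordinal sr))) => [|i]; last first.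
  by rewrite /= (inj_eq (mulIf s0)) eqr_nat.
by rewrite big_pred1_eq /o /= => /eqP; rewrite scaler_eq0 (negbTE (_ : lead_coef r != 0))
  ?lead_coef_eq0 //= => /eqP.
Qed.

(* A monic relation is homogeneous for the grading by ad D, in which no power
   of a can be compensated by powers of y. *)
Lemma negative_weight_nilpotent D y a p k (P : {poly {poly K}}) :
  comr D y = p *: y -> p != 0 -> comr D a = - (k.+1%:R * p) *: a ->
  P \is monic -> (map_poly (horner_alg y) P).[a] = 0 -> nilpotent a.
Proof.
move=> hy p0 ha Pm hP; exists (size P).-1.
have sP : (0 < size P)%N by rewrite lt0n size_poly_eq0 monic_neq0.
pose m := \max_(j < size P) size (P`_j)%R.
have sm j : (size (P`_j)%R <= m.+1)%N.
  case: (ltnP j (size P)) => hj; last by rewrite nth_default ?size_poly0.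
  rewrite ltnW // ltnS /m; have := @leq_bigmax _ (fun j : 'I_(size P) => size (P`_j)%R)
    (Ordinal hj).
  by apply: leq_trans.
have eP : \sum_(u : 'I_(size P) * 'I_m.+1) P`_u.1`_u.2 *: (y ^+ u.2 * a ^+ u.1) = 0.
  rewrite -[RHS]hP (horner_coef_wide _ (size_poly _ _)).
  rewrite -(pair_big xpredT xpredT (fun (j : 'I_(size P)) (i : 'I_m.+1) => P`_j`_i *: (y ^+ i *
    a ^+ j))) /=.
  apply: eq_bigr => j _; rewrite coef_map /= horner_algE.
  rewrite (big_ord_widen _ (fun i => P`_j`_i *: y ^+ i) (sm j)).
  rewrite [in RHS]big_mkcond mulr_suml /=; apply: eq_bigr => i _.
  by case: ltnP => hi; rewrite ?scalerAl // nth_default // scale0r mul0r.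
pose w (u : 'I_(size P) * 'I_m.+1) : K := u.2%:R * p - u.1%:R * (k.+1%:R * p).
have ho (u : 'I_(size P) * 'I_m.+1) : comr D (P`_u.1`_u.2 *: (y ^+ u.2 * a ^+ u.1)) =
    w u *: (P`_u.1`_u.2 *: (y ^+ u.2 * a ^+ u.1)).
  rewrite linearZ /= (comr_eigenM (comr_eigenX _ hy) (comr_eigenX _ ha)) !scalerA.
  by congr (_ *: _); rewrite /w; ring.
have sP' : ((size P).-1 < size P)%N by rewrite prednK.
pose u0 : 'I_(size P) * 'I_m.+1 := (Ordinal sP', ord0).
have := comr_eigen_sum (w u0) ho eP.
rewrite (eq_bigl (pred1 u0)) => [|[j i]]; last first.
  rewrite /= -subr_eq0.
  (* This is p times a sum of natural numbers, zero only at i = 0 and j = deg P: the leading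
     monomial [u0] is alone in its weight. *)
  have -> : w (j, i) - w u0 = (i + ((size P).-1 - j) * k.+1)%:R * p.
    rewrite /w /= natrD natrM natrB; last by rewrite -ltnS prednK.
    by ring.
  rewrite mulf_eq0 (negbTE p0) orbF pnatr_eq0 addn_eq0 muln_eq0 orbF subn_eq0.
  rewrite xpair_eqE -!val_eqE /= andbC; congr (_ && _).
  by rewrite eqn_leq -[X in X && _]ltnS prednK // ltn_ord.
rewrite big_pred1_eq /= (_ : P`_(size P).-1 = 1) ?coef1 ?eqxx; last exact/monicP.
by rewrite expr0 scale1r mul1r.
Qed.

(** By induction on i, a^(n - i) b^(2 i) = 0: apply ad D and multiply by b, so that the term
    differentiating b^(2 i) contains the previous relation. At i = n only b is left. *)
Lemma nilpotent_comr D a b :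
  comr D a = b -> GRing.comm a b -> GRing.comm a (comr D b) ->
  GRing.comm b (comr D b) -> nilpotent a -> nilpotent b.
Proof.
move=> ha ab ab' bb' [n an]; pose b' := comr D b.
have DexpS c m : GRing.comm c (comr D c) ->
    comr D (c ^+ m.+1) = m.+1%:R *: (c ^+ m * comr D c).
  move=> cc'; elim: m => [|m IH]; first by rewrite expr1 expr0 mul1r scale1r.
  rewrite exprSr comrMr IH -scalerAl -mulrA -cc' mulrA -exprSr.
  by rewrite -[X in _ + X]scale1r -scalerDl natr1.
have Dexp c m : GRing.comm c (comr D c) ->
    comr D (c ^+ m) * c = m%:R *: (c ^+ m * comr D c).
  move=> cc'; case: m => [|m].
    by rewrite scale0r [comr D _]comr_comm ?mul0r //; exact: commr1.
  by rewrite DexpS // -scalerAl -mulrA -cc' mulrA -exprSr.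
have key i : (i <= n)%N -> a ^+ (n - i) * b ^+ i.*2 = 0.
  elim: i => [|i IH] hi; first by rewrite subn0 an mul0r.
  have := IH (ltnW hi); rewrite -(subnSK hi) => h.
  have : comr D (a ^+ (n - i.+1).+1 * b ^+ i.*2) = 0 by rewrite h linear0.
  rewrite comrMr => /(congr1 (fun t => t * b)).
  rewrite mulrDl -mulrA -exprSr -mulrA Dexp // -scalerAr mulrA h mul0r scaler0 addr0.
  rewrite DexpS ?ha // -scalerAl -mulrA -exprS mul0r => /eqP.
  by rewrite scaler_eq0 pnatr_eq0 /= doubleS => /eqP.
have := key n (leqnn n); rewrite subnn expr0 mul1r => h; by exists n.*2.
Qed.

End Nilpotent.

(** * Alternating squares of a current *)

Section AlternatingSquare.
Variables (K : numClosedFieldType) (A : algType K).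
Implicit Types (y D : A) (X : nat -> A).

(* n! times the coefficient of λ^n in X_{-λ} X_λ: the sign makes it commute
   with ∂. *)
Definition alt_square X n : A :=
  \sum_(i < n.+1) ((-1) ^+ i * 'C(n, i)%:R) *: (X i * X (n - i)%N).

(** ad y lowers the index of either factor; the two resulting sums cancel after a shift, by (i + 1)
    C(n, i + 1) = (n - i) C(n, i) and the alternating sign. *)
Lemma alt_square_comm X y q n :
  (forall m, comr y (X m) = (m%:R * q) *: X m.-1) -> comr y (alt_square X n) = 0.
Proof.
move=> hX; rewrite linear_sum /=.
under eq_bigr do rewrite linearZ /= comrMr !hX scalerDr -scalerAl -scalerAr !scalerA.
rewrite big_split /= [X in X + _]big_ord_recl [X in _ + X]big_ord_recr /= subnn !mul0r !mulr0
  scale0r.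
rewrite scale0r add0r addr0 -big_split big1 // => i _ /=.
have -> : (n - bump 0 i = (n - i).-1)%N by rewrite /bump; lia.
rewrite -scalerDl /bump /= add1n exprS.
have h : (i.+1%:R * 'C(n, i.+1)%:R = (n - i)%:R * 'C(n, i)%:R :> K).
  by rewrite -!natrM mul_bin_left.
rewrite (_ : _ + _ = 0) ?scale0r //.
transitivity ((-1) ^+ i * q * ((n - i)%:R * 'C(n, i)%:R - i.+1%:R * 'C(n, i.+1)%:R) : K).
  by ring.
by rewrite h subrr mulr0.
Qed.

Lemma alt_square_weight X D s p n :
  (forall m, comr D (X m) = (s - m%:R * p) *: X m) ->
  comr D (alt_square X n) = (s *+ 2 - n%:R * p) *: alt_square X n.
Proof.
move=> hX; rewrite linear_sum scaler_sumr; apply: eq_bigr => i _.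
rewrite linearZ /= (comr_eigenM (hX _) (hX _)) !scalerA; congr (_ *: _).
by rewrite natrB -1?ltnS //; ring.
Qed.

Lemma alt_square2 X : alt_square X 2%N = X 0%N * X 2%N - 2 *: (X 1%N * X 1%N) + X 2%N * X 0%N.
Proof.
rewrite /alt_square !big_ord_recl big_ord0 /= /bump /= !subn0 addr0 addrA.
by rewrite subn1 subnn /= !expr0 !expr1 expr2 !mul1r mulrNN !mul1r mulN1r scaleNr !scale1r.
Qed.

Lemma alt_square4 X : alt_square X 4%N =
  X 0%N * X 4%N - 4 *: (X 1%N * X 3%N) + 6 *: (X 2%N * X 2%N) - 4 *: (X 3%N * X 1%N) + X 4%N *
    X 0%N.
Proof.
have b2 : 'C(4, 2) = 6 by [].
have b3 : 'C(4, 3) = 4 by [].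
rewrite /alt_square !big_ord_recl big_ord0 /= /bump /= addr0 !addrA !subSS !subn0.
rewrite -scaleNr -[in RHS]scaleNr.
by rewrite -[X 0%N * X 4%N in RHS]scale1r -[X 4%N * X 0%N in RHS]scale1r; do ![congr (_ + _)];
  congr (_ *: _); rewrite ?bin0 ?bin1 ?binn ?b2 ?b3; ring.
Qed.

End AlternatingSquare.

Section Vectors.
Variables (K : numClosedFieldType) (A : algType K) (V : lmodType A).
Implicit Types (a : A) (v w : V).

Lemma alg_scaleI (k : K) v : k != 0 -> k%:A *: v = 0 -> v = 0.
Proof.
move=> k0 /(congr1 (fun w => k^-1%:A *: w)).
by rewrite scaler0 scalerA mulr_algl scalerA mulVf // !scale1r.
Qed.

Lemma scale_alg (k : K) a v : (k *: a) *: v = k%:A *: (a *: v).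
Proof. by rewrite scalerA mulr_algl. Qed.

Lemma scale_algC (k : K) a v : a *: (k%:A *: v) = k%:A *: (a *: v).
Proof. by rewrite !scalerA mulr_algr mulr_algl. Qed.

Lemma comr_scale a b v : a *: (b *: v) = b *: (a *: v) + comr a b *: v.
Proof. by rewrite !scalerA -scalerDl -mulr_comr. Qed.

Lemma nilpotent_kernel (Y : V -> Prop) a v n :
  (forall w, Y w -> Y (a *: w)) -> Y v -> v <> 0 -> a ^+ n *: v = 0 ->
  exists w, [/\ Y w, w <> 0 & a *: w = 0].
Proof.
move=> hY; elim: n v => [|n IH] v Yv v0; first by rewrite expr0 scale1r.
rewrite exprSr -scalerA => h; have [av0|av0] := eqVneq (a *: v) 0; first by exists v.
by apply: IH h; [exact: hY|exact/eqP].
Qed.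

Lemma polynomial_eigenvector (Y : V -> Prop) a v (g : {poly K}) :
  (forall w, Y w -> Y (a *: w)) -> (forall k w, Y w -> Y (k%:A *: w)) ->
  (forall w w', Y w -> Y w' -> Y (w - w')) ->
  Y v -> v <> 0 -> g != 0 -> horner_alg a g *: v = 0 ->
  exists w h, [/\ Y w, w <> 0 & a *: w = h%:A *: w].
Proof.
move=> Ya Yk YB Yv v0 g0; have [r ->] := closed_field_poly_normal g.
rewrite -mul_polyC rmorphM /= horner_algC -scalerA => /(alg_scaleI _).
rewrite lead_coef_eq0 => /(_ g0); elim: r v Yv v0 => [|z r IH] v Yv v0.
  by rewrite big_nil rmorph1 scale1r.
rewrite big_cons mulrC rmorphM rmorphB /= horner_algX horner_algC -scalerA scalerBl.
have [e|ne] := eqVneq (a *: v - z%:A *: v) 0.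
  by move=> _; exists v, z; split=> //; apply/eqP; rewrite -subr_eq0 e.
by apply: IH; [apply: YB; [exact: Ya|exact: Yk]|exact/eqP].
Qed.

Lemma horner_alg_scale a b v (g : {poly K}) (Y : V -> Prop) :
  (forall w, Y w -> a *: w = b *: w) -> (forall w, Y w -> Y (b *: w)) ->
  Y v -> horner_alg a g *: v = horner_alg b g *: v.
Proof.
move=> hab hY; elim/poly_ind: g v => [|g c IH] v Yv; first by rewrite !rmorph0 !scale0r.
rewrite !(rmorphD, rmorphM) /= !horner_algX !horner_algC !scalerDl -!scalerA.
by rewrite hab // IH //; exact: hY.
Qed.

Lemma horner_alg_eigen a h v (g : {poly K}) :
  a *: v = h%:A *: v -> horner_alg a g *: v = g.[h]%:A *: v.
Proof.
move=> ha; elim/poly_ind: g => [|g c IH]; first by rewrite rmorph0 horner0 !scale0r.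
rewrite !(rmorphD, rmorphM) /= horner_algX horner_algC hornerMXaddC !scalerDl -!scalerA ha.
by rewrite scale_algC IH [in RHS]scale_alg scale_algC.
Qed.

End Vectors.

(** * Singular vectors *)

Section Descent.
Variables (K : numClosedFieldType) (A : algType K) (V : lmodType A).

(** In every other term one factor has index above m and can be moved next to v. *)
Lemma alt_square_top (X : nat -> A) m (v : V) :
  (forall i, (m < i)%N -> X i *: v = 0) ->
  (forall i j, (i + j = m.*2)%N -> comr (X i) (X j) *: v = 0) ->
  alt_square X m.*2 *: v = ((-1) ^+ m * 'C(m.*2, m)%:R *: (X m * X m)) *: v.
Proof.
move=> h0 hc; have hm : (m < m.*2.+1)%N by lia.
rewrite /alt_square scaler_suml (bigD1 (Ordinal hm)) //= big1 ?addr0.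
  by rewrite -addnn addnK.
move=> i; rewrite -val_eqE /= => im; rewrite scale_alg -scalerA.
have [lt|ge] := ltnP m i; last by rewrite h0 ?scaler0 //; lia.
by rewrite [X in _ *: X]comr_scale h0 // scaler0 add0r hc ?scaler0 //; have := ltn_ord i; lia.
Qed.

(** On Y the alternating square of G f is a nonzero multiple of (G f m)^2, so its nilpotency makes G
    f m nilpotent there. The list is treated one index at a time, inside the vectors killed by the
    indices already done. *)
Lemma descent_step (J : eqType) (G : J -> nat -> A) m (S : {pred J}) :
  let Y w := forall h k, (m < k)%N -> G h k *: w = 0 in
  (forall f g i w, f \in S -> (m < i)%N -> Y w -> comr (G g i) (G f m) *: w = 0) ->
  (forall f g i j w, f \in S -> g \in S -> (i + j = m.*2)%N -> Y w ->
    comr (G f i) (G g j) *: w = 0) ->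
  (forall f, f \in S -> nilpotent (alt_square (G f) m.*2)) ->
  (exists2 v : V, v <> 0 & Y v) ->
  forall l : seq J, {subset l <= S} ->
  exists v : V, [/\ v <> 0, Y v & forall f, f \in l -> G f m *: v = 0].
Proof.
move=> Y hY1 hY2 hN [v0 v00 Yv0]; elim=> [|f l IH] hl; first by exists v0.
have [|v [v1 Yv hv]] := IH; first by move=> g gl; apply: hl; rewrite inE gl orbT.
have fS : f \in S by apply: hl; rewrite inE eqxx.
pose Z w := Y w /\ forall g, g \in l -> G g m *: w = 0.
have ZY w : Z w -> Z (G f m *: w).
  move=> [Yw hw]; split=> [g i mi|g gl]; rewrite comr_scale.
    by rewrite Yw // scaler0 add0r hY1.
  rewrite hw // scaler0 add0r hY2 ?addnn //.
  by apply: hl; rewrite inE gl orbT.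
have [n an] := hN f fS.
pose b := (-1) ^+ m * 'C(m.*2, m)%:R *: (G f m * G f m) : A.
have bE (w : V) : b *: w = ((-1) ^+ m * 'C(m.*2, m)%:R)%:A *: (G f m *: (G f m *: w)).
  by rewrite /b scale_alg -scalerA.
have Zk (k : K) w : Z w -> Z (k%:A *: w).
  move=> [Yw hw]; split=> [g i mi|g gl]; rewrite scale_algC.
    by rewrite Yw ?scaler0.
  by rewrite hw ?scaler0.
have hb : b ^+ n *: v = 0.
  have := @horner_alg_scale K A V (alt_square (G f) m.*2) b v 'X^n Z.
  rewrite !rmorphXn /= !horner_algX an scale0r => <- //.
  - move=> w [Yw hw]; apply: alt_square_top => [i mi|i j ij]; first exact: Yw.
    exact: hY2.
  - by move=> w Zw; rewrite bE; apply/Zk/ZY/ZY.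
move: hb; rewrite /b exprZn scale_alg => /alg_scaleI hb.
have c0 : ((-1) ^+ m * 'C(m.*2, m)%:R : K) ^+ n != 0.
  rewrite expf_neq0 // mulf_neq0 ?signr_eq0 // pnatr_eq0 -lt0n bin_gt0; lia.
have {hb} := hb c0; rewrite -expr2 -exprM => hb.
have [w [[Yw hw] w0 fw]] := nilpotent_kernel ZY (conj Yv hv) v1 hb.
by exists w; split=> // g; rewrite inE => /orP[/eqP ->|/hw].
Qed.

End Descent.

Lemma horner_alg_comp (K : fieldType) (A : algType K) (a : A) (r q : {poly K}) :
  horner_alg a (r \Po q) = horner_alg (horner_alg a q) r.
Proof.
elim/poly_ind: r => [|r c IH]; first by rewrite comp_poly0 !rmorph0.
by rewrite comp_polyD comp_polyM comp_polyX comp_polyC !(rmorphD, rmorphM) /= IH !horner_algX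
  !horner_algC.
Qed.

Lemma horner_alg_stable (K : fieldType) (A : algType K) (V : lmodType A) (Y : V -> Prop)
    (a : A) (q : {poly K}) (v : V) :
  (forall w, Y w -> Y (a *: w)) -> (forall k u w, Y u -> Y w -> Y (k%:A *: u + w)) ->
  Y 0 -> Y v -> Y (horner_alg a q *: v).
Proof.
move=> Ya YD Y0; elim/poly_ind: q v => [|q c IH] v Yv; first by rewrite rmorph0 scale0r.
rewrite !(rmorphD, rmorphM) /= horner_algX horner_algC scalerDl -scalerA addrC.
by apply: (YD) => //; apply/IH/Ya.
Qed.

(** * Primary currents over a Virasoro-type family *)

Section Virasoro.
Variables (K : numClosedFieldType) (A : algType K) (V : lmodType A).
Variables (p : K) (D : nat -> A).
Hypothesis p0 : p != 0.
(** Up to the factor p, D(n) behaves as the Virasoro mode L_(n-1). The predecessor is truncated only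
    at m = n = 0, where the coefficient vanishes. *)
Hypothesis comrDD : forall m n,
  comr (D m) (D n) = ((m%:R - n%:R) * p) *: D (m + n).-1.
Hypothesis D0_integral : forall T : A, GRing.comm T (D 0%N) ->
  exists2 P, P \is monic & (map_poly (horner_alg (D 0%N)) P).[T] = 0.
Hypothesis D0_inj : forall v : V, D 0%N *: v = 0 -> v = 0.
Hypothesis V_faithful : forall a : A, (forall v : V, a *: v = 0) -> a = 0.
Hypothesis V_neq0 : exists v : V, v <> 0.

Definition locally_finite (X : nat -> A) :=
  forall v : V, exists N, forall n, (N <= n)%N -> X n *: v = 0.

Hypothesis D_finite : locally_finite D.

(* The brackets of D with a primary field of conformal weight 1 + s / p. *)
Definition primary (X : nat -> A) (s : K) := forall m n,
  comr (D m) (X n) = (m%:R * s - n%:R * p) *: X (m + n).-1.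

Lemma primary_D : primary D p.
Proof. by move=> m n; rewrite comrDD mulrBl. Qed.

Lemma primary_weight X s n : primary X s -> comr (D 1%N) (X n) = (s - n%:R * p) *: X n.
Proof. by move=> h; rewrite h mul1r. Qed.

Lemma primary_comr0 X s n : primary X s -> comr (D 0%N) (X n) = (n%:R * - p) *: X n.-1.
Proof. by move=> h; rewrite h mul0r sub0r mulrN. Qed.

Lemma D0_expI e (v : V) : D 0%N ^+ e *: v = 0 -> v = 0.
Proof.
by elim: e => [|e IH]; rewrite ?expr0 ?scale1r // exprS -scalerA => /D0_inj/IH.
Qed.

Lemma algebraic_of_relation E T b k : comr E T = 0 -> comr E (D 0%N) = b ->
  comr E b = k *: b -> GRing.comm b (D 0%N) -> GRing.comm b T -> GRing.comm T (D 0%N) ->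
  exists e (r : {poly K}), r != 0 /\ b ^+ e * horner_alg T r = 0.
Proof.
move=> ET ED Eb bD bT TD; have [P Pm hP] := D0_integral TD.
exact: comr_relation ET ED Eb bD bT TD (monic_neq0 Pm) hP.
Qed.

(** D(1) commutes with T and ad D(1) scales D(0), so differentiating an integral equation of T
    leaves D(0)^e r(T) = 0 up to a scalar; D(0) is injective and can be cancelled. *)
Lemma weight0_algebraic T : GRing.comm T (D 0%N) -> comr (D 1%N) T = 0 ->
  exists2 r : {poly K}, r != 0 & horner_alg T r = 0.
Proof.
move=> TD DT; have D10 : comr (D 1%N) (D 0%N) = p *: D 0%N.
  by rewrite comrDD subr0 mul1r.
have cZ a : GRing.comm (D 0%N) a -> GRing.comm (p *: D 0%N) a.
  by rewrite /GRing.comm -scalerAl -scalerAr => ->.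
have [||||e [r [r0 hr]]] := @algebraic_of_relation (D 1%N) T (p *: D 0%N) p DT D10.
- by rewrite linearZ /= D10.
- exact: cZ.
- by apply: cZ; apply: commr_sym.
- by [].
exists r => //; apply: V_faithful => v; apply: (@D0_expI e).
move: hr; rewrite exprZn -scalerAl => /eqP; rewrite scaler_eq0 expf_eq0 (negbTE p0) andbF /=.
by rewrite scalerA => /eqP ->; rewrite scale0r.
Qed.

Lemma alt_square_nilpotent X s n k : primary X s ->
  s *+ 2 - n%:R * p = - (k.+1%:R * p) -> nilpotent (alt_square X n).
Proof.
move=> hX hs; have cD : GRing.comm (alt_square X n) (D 0%N).
  apply: commr_sym; apply: comm_comr; apply: (@alt_square_comm _ _ _ _ (- p)) => m.
  exact: primary_comr0 hX.
have [P Pm hP] := D0_integral cD.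
apply: (negative_weight_nilpotent _ p0 _ Pm hP (D := D 1%N) (k := k)).
  by rewrite comrDD subr0 mul1r.
by rewrite -hs; apply: alt_square_weight => m; apply: primary_weight.
Qed.

(** [alt_square D 2] has weight 0, hence is algebraic, and on the vectors in question it is a
    quadratic polynomial in D(1). *)
Lemma D1_relation : exists2 g : {poly K}, g != 0 &
  forall v : V, (forall m, (2 <= m)%N -> D m *: v = 0) -> horner_alg (D 1%N) g *: v = 0.
Proof.
have [||r r0 hr] := @weight0_algebraic (alt_square D 2%N).
- apply: commr_sym; apply: comm_comr; apply: (@alt_square_comm _ _ _ _ (- p)) => m.
  exact: primary_comr0 primary_D.
- rewrite (@alt_square_weight _ _ _ _ p p) => [|m]; last exact: primary_weight primary_D.
  by rewrite (_ : _ - _ = 0) ?scale0r //; ring.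
(* This is D(0)D(2) - 2 D(1)^2 + D(2)D(0) on a vector killed by D(2), as [D(2), D(0)] = 2 p D(1). *)
pose q : {poly K} := (2 * p) *: 'X - 2 *: 'X^2.
have sq : (1 < size q)%N.
  rewrite ltnNge; apply: contraNN p0 => /leq_sizeP/(_ 1%N isT) /eqP.
  rewrite /q coefB !coefZ coefX coefXn /= mulr1 mulr0 subr0 mulf_eq0 pnatr_eq0 //.
exists (r \Po q).
  rewrite comp_poly_eq0 // sq.
move=> v Yv; rewrite horner_alg_comp.
pose Y (w : V) := forall m, (2 <= m)%N -> D m *: w = 0.
rewrite -(@horner_alg_scale K A V (alt_square D 2%N) _ v r Y) ?hr ?scale0r //.
- move=> w Yw; rewrite alt_square2 2!scalerDl scaleNr -[(_ * _) *: w]scalerA Yw // scaler0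
  add0r.
  rewrite -[(_ * _) *: w]scalerA comr_scale Yw // scaler0 add0r comrDD subr0.
  rewrite /q rmorphB /= !linearZ /= horner_algX rmorphXn /= horner_algX expr2 !mulr_algl
    [RHS]scalerBl. by rewrite scalerN addrC.
- move=> w Yw; apply: (@horner_alg_stable _ _ _ Y) => //.
  + by move=> u Yu m m2; rewrite comr_scale Yu // scaler0 add0r comrDD addn1 scale_alg Yu
    ?scaler0.
  + by move=> k u u' Yu Yu' m m2; rewrite scalerDr scale_algC Yu // Yu' // scaler0 addr0.
  + by move=> m m2; rewrite scaler0.
Qed.

(** Local finiteness gives a vector killed by all high modes, and [descent_step] lowers the bound as
    long as the alternating squares have negative weight. The relation for D(1) then yields an
    eigenvector. *)
Theorem singular_vector (J : finType) (X : J -> nat -> A) :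
  (forall j, primary (X j) 0) ->
  (forall i j m n, GRing.comm (X i m) (X j n)) ->
  (forall j, locally_finite (X j)) ->
  exists (v : V) h, [/\ v <> 0, forall m, (2 <= m)%N -> D m *: v = 0,
    D 1%N *: v = h%:A *: v & forall j n, (1 <= n)%N -> X j n *: v = 0].
Proof.
move=> hX cX fX; pose G (f : option J) := if f is Some j then X j else D.
have GG f g i j : exists (c : K) h, comr (G f i) (G g j) = c *: G h (i + j).-1.
  case: f g => [f|] [g|] /=.
  - by exists 0, None; rewrite scale0r comr_comm.
  - by rewrite comrC hX -scaleNr addnC; eexists; exists (Some f).
  - by rewrite hX; eexists; exists (Some g).
  - by rewrite comrDD; eexists; exists None.
pose Y m (w : V) := forall h k, (m < k)%N -> G h k *: w = 0.
have GY f g i j m w : (m < (i + j).-1)%N -> Y m w -> comr (G f i) (G g j) *: w = 0.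
  move=> lt Yw; have [c [h ->]] := GG f g i j.
  by rewrite scale_alg Yw ?scaler0.
have [v0 v00] := V_neq0.
have Gfin f : locally_finite (G f) by case: f.
have [N hN] : exists N : option J -> nat, forall f n, (N f <= n)%N -> G f n *: v0 = 0.
  exact: (fin_all_exists (fun f => Gfin f v0)).
have {N hN v0 v00} [N [v0 v00 Yv0]] : exists N, exists2 v : V, v <> 0 & Y N.+1 v.
  exists (\max_f N f), v0 => // h k lt; apply: hN.
  exact: leq_trans (leq_bigmax h) (ltnW (ltnW lt)).
have {N v0 v00 Yv0} [v0 v00 Yv0] : exists2 v : V, v <> 0 & Y 1%N v.
  elim: N v0 v00 Yv0 => [|N IH] v v00 Yv; first by exists v.
  have [|||||w [w0 Yw hw]] := @descent_step _ _ V _ G N.+2 xpredT _ _ _ _ (enum {: option J}).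
  - by move=> f g i w _ lt Yw; apply: GY Yw; lia.
  - by move=> f g i j w _ _ e Yw; apply: GY Yw; lia.
  - move=> [j|] _ /=.
      apply: (alt_square_nilpotent (hX j) (k := N.*2.+3)).
      by rewrite mul0rn sub0r; congr (- (_%:R * _)); lia.
    apply: (alt_square_nilpotent primary_D (k := N.*2.+1)).
    rewrite (_ : N.+2.*2 = (N.*2.+1).+1 + 2)%N; last by lia.
    by rewrite natrD; ring.
  - by exists v.
  - by [].
  apply: (IH w w0) => h k; rewrite leq_eqVlt => /orP[/eqP <-|/Yw //].
  by apply: hw; rewrite mem_enum.
(* At mode 1 the square of D has weight 0, so the descent goes on with the commuting X j only. *)
have [|||||w [w0 Yw hw]] := @descent_step _ _ V _ G 1%N isSome _ _ _ _ (map Some (enum J)).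
- by move=> f g i w _ lt Yw; apply: GY Yw; lia.
- move=> [f|//] [g|//] i j w _ _ e Yw /=.
  by rewrite comr_comm ?scale0r.
- move=> [j|//] _ /=; apply: (alt_square_nilpotent (hX j) (k := 1)).
  by rewrite mul0rn sub0r.
- by exists v0.
- by move=> _ /mapP[j _ ->].
pose Z (v : V) := (forall m, (2 <= m)%N -> D m *: v = 0) /\ forall j n, (1 <= n)%N -> X j n *:
  v = 0.
have Zw : Z w.
  split=> [m m2|j n]; first exact: (Yw None).
  rewrite leq_eqVlt => /orP[/eqP <-|n1]; last exact: (Yw (Some j)).
  by apply: (hw (Some j)); rewrite map_f ?mem_enum.
have [g g0 hg] := D1_relation.
have [|||v [h [[Dv Xv] v0' hv]]] := polynomial_eigenvector _ _ _ Zw w0 g0 (hg w Zw.1) .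
- move=> u [Du Xu]; split=> [m m2|j n n1]; rewrite comr_scale.
    by rewrite Du // scaler0 add0r comrDD addn1 scale_alg Du ?scaler0.
  by rewrite Xu // scaler0 add0r comrC (primary_weight _ (hX j)) scaleNr scale_alg Xu ?scaler0
    ?oppr0.
- move=> k u [Du Xu]; split=> [m m2|j n n1]; rewrite scale_algC ?Du ?Xu ?scaler0 //.
- move=> u u' [Du Xu] [Du' Xu']; split=> [m m2|j n n1]; rewrite scalerBr ?Du ?Du' ?Xu ?Xu'
  ?subr0 //.
by exists v, h.
Qed.

Lemma alt_square_commD0 X s n : primary X s -> GRing.comm (alt_square X n) (D 0%N).
Proof.
move=> hX; apply: commr_sym; apply: comm_comr.
by apply: (@alt_square_comm _ _ _ _ (- p)) => m; exact: primary_comr0 hX.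
Qed.

(* Let X(n0) v be the last nonzero X(n) v. It is singular, so its D 1-weight z
   is a root of a fixed polynomial, and s is determined by n0 and z. If n0 is
   at least 2N, where N is the order of nilpotency of alt_square D 4, then
   applying alt_square D 4 N times to X(n0 - 2N) v yields X(n0) v multiplied by
   a product of quadratic polynomials in s with leading coefficient 6. *)
Theorem primary_types_acting (v : V) (h : K) :
  v <> 0 -> (forall m, (2 <= m)%N -> D m *: v = 0) -> D 1%N *: v = h%:A *: v ->
  exists2 B : {poly K}, B != 0 & forall X s, primary X s -> locally_finite X ->
    (exists n, X n *: v <> 0) -> root B s.
Proof.
move=> v0 Dv D1v; have [g g0 hg] := D1_relation.
have [rs grs] := closed_field_poly_normal g.
have [N hN] : nilpotent (alt_square D 4).
  by apply: (alt_square_nilpotent primary_D (k := 1)); ring.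
(* With z the D(1)-weight of X(n0) v and j = n0 - 2 l, one has s - j p = e and s - j p + h = f; then
   q is the scalar [C j] below, written as a quadratic in s. *)
pose e z l : K := - h + z + l.*2%:R * p.
pose f z l : K := z + l.*2%:R * p.
pose q z l := Poly [:: 12 * p * e z l - 8 * f z l * e z l + 6 * e z l * (e z l - p);
  18 * p - 16 * f z l + 12 * e z l; 6].
pose B := \prod_(z <- rs) ((\prod_(n < N.*2) ('X - (n%:R * p - h + z)%:P)) *
  \prod_(l < N) q z l.+1).
exists B.
  rewrite prodf_seq_neq0; apply/allP => z _ /=.
  rewrite mulf_neq0 //; first by apply/prodf_neq0 => n _; exact/monic_neq0/monicXsubC.
  apply/prodf_neq0 => l _; apply: contraTneq isT => /(congr1 (fun r : {poly K} => r`_2)) /eqP.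
  by rewrite coef_Poly coef0 /= pnatr_eq0.
move=> X s hX fX [n1 Xn1].
have [n0 Xn0 n0max] : exists2 n0, X n0 *: v <> 0 & forall n, (n0 < n)%N -> X n *: v = 0.
  have [M hM] := fX v.
  have ex : exists n, X n *: v != 0 by exists n1; apply/eqP.
  have bd n : X n *: v != 0 -> (n <= M)%N.
    by move=> Xn; rewrite leqNgt; apply: contra Xn => /ltnW/hM ->.
  have [n0 Xn0 hn0] := ex_maxnP ex bd; exists n0; first exact/eqP.
  by move=> n lt; apply/eqP; apply: contraTT lt => /hn0; rewrite -leqNgt.
pose u := X n0 *: v.
have DX m j : (2 <= m)%N ->
    D m *: (X j *: v) = (m%:R * s - j%:R * p)%:A *: (X (m + j).-1 *: v).
  by move=> m2; rewrite comr_scale Dv // scaler0 add0r hX scale_alg.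
have D1X j : D 1%N *: (X j *: v) = (s - j%:R * p + h)%:A *: (X j *: v).
  rewrite comr_scale D1v scale_algC (primary_weight _ hX) [X in _ + X]scale_alg.
  by rewrite -scalerDl -scalerDl addrC.
pose z := s - n0%:R * p + h.
have gz : g.[z] = 0.
  apply/eqP; apply: contraT => gz; case: Xn0; apply: (alg_scaleI gz).
  rewrite -(horner_alg_eigen g (D1X n0)); apply: hg => m m2.
  by rewrite DX // n0max ?scaler0 //; lia.
have zrs : z \in rs.
  by move: gz; rewrite grs hornerZ => /eqP; rewrite mulf_eq0 lead_coef_eq0 (negbTE g0) /=
    -rootE root_prod_XsubC.
rewrite rootE horner_prod prodf_seq_eq0; apply/hasP; exists z => //=.
rewrite hornerM mulf_eq0 !horner_prod; apply/orP; have [lt|ge] := ltnP n0 N.*2.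
  left; rewrite prodf_seq_eq0; apply/hasP; exists (Ordinal lt) => //=; first exact:
    mem_index_enum.
  by rewrite hornerXsubC /z; apply/eqP; ring.
right; pose c := alt_square D 4.
(* The scalar by which c carries X(j) v to X(j + 2) v, modulo the image of D(0). *)
pose C (j : nat) : K := 12 * p * (3 * s - j%:R * p)
    - 8 * (s - j%:R * p + h) * (3 * s - j%:R * p)
    + 6 * (2 * s - j%:R * p) * (2 * s - j%:R * p - p).
have cU j : c *: (X j *: v) = (C j)%:A *: (X j.+2 *: v) +
    (2 * (4 * s - j%:R * p))%:A *: (D 0%N *: (X j.+3 *: v)).
  have D2 i : D 2 *: (X i *: v) = (2 * s - i%:R * p)%:A *: (X i.+1 *: v) := DX 2 i isT.
  have D3 i : D 3 *: (X i *: v) = (3 * s - i%:R * p)%:A *: (X i.+2 *: v) := DX 3 i isT.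
  have D4 i : D 4 *: (X i *: v) = (4 * s - i%:R * p)%:A *: (X i.+3 *: v) := DX 4 i isT.
  have algM (k l : K) (w : V) : k%:A *: (l%:A *: w) = (k * l)%:A *: w.
    by rewrite scalerA mulr_algl scalerA.
  have algD (k l : K) (w : V) : k%:A *: w + l%:A *: w = (k + l)%:A *: w.
    by rewrite -scalerDl -scalerDl.
  have algN (k : K) (w : V) : - (k%:A *: w) = (- k)%:A *: w by rewrite -scaleNr -scaleNr.
  have E40 : D 4 *: (D 0%N *: (X j *: v)) = (4 * s - j%:R * p)%:A *: (D 0%N *: (X j.+3 *: v))
      + ((4 * p) * (3 * s - j%:R * p))%:A *: (X j.+2 *: v).
    rewrite comr_scale D4 scale_algC comrDD subr0 addn0 [X in _ + X]scale_alg /=.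
    by rewrite D3 algM.
  have E04 : D 0%N *: (D 4 *: (X j *: v)) = (4 * s - j%:R * p)%:A *: (D 0%N *: (X j.+3 *: v)).
    by rewrite D4 scale_algC.
  have E13 : D 1%N *: (D 3 *: (X j *: v)) =
      ((3 * s - j%:R * p) * (s - j.+2%:R * p + h))%:A *: (X j.+2 *: v).
    by rewrite D3 scale_algC D1X algM.
  have E31 : D 3 *: (D 1%N *: (X j *: v)) =
      ((s - j%:R * p + h) * (3 * s - j%:R * p))%:A *: (X j.+2 *: v).
    by rewrite D1X scale_algC D3 algM.
  have E22 : D 2 *: (D 2 *: (X j *: v)) =
      ((2 * s - j%:R * p) * (2 * s - j.+1%:R * p))%:A *: (X j.+2 *: v).
    by rewrite D2 scale_algC D2 algM.
  rewrite /c alt_square4 4!scalerDl 2!scaleNr (scale_alg 4 (D 1%N * D 3)) (scale_alg 4 (D 3 * D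
    1%N)) (scale_alg 6).
  rewrite -[(D 0%N * D 4) *: _]scalerA -[(D 1%N * D 3) *: _]scalerA -[(D 2 * D 2) *: _]scalerA.
  rewrite -[(D 3 * D 1%N) *: _]scalerA -[(D 4 * D 0%N) *: _]scalerA.
  rewrite E40 E04 E13 E31 E22 !algM !algN addrA.
  rewrite [LHS](ACl ((2*3*4*6)*(1*5))) /= !algD; congr (_%:A *: _ + _%:A *: _).
    by rewrite /C -[j.+2]addn2 -[j.+1]addn1 !natrD; ring.
  by ring.
have cD l : GRing.comm (c ^+ l) (D 0%N).
  by apply/commr_sym/commrX/commr_sym/(alt_square_commD0 _ primary_D).
have cS l j : c ^+ l.+1 *: (X j *: v) = (C j)%:A *: (c ^+ l *: (X j.+2 *: v)) +
    (2 * (4 * s - j%:R * p))%:A *: (D 0%N *: (c ^+ l *: (X j.+3 *: v))).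
  rewrite exprSr -scalerA cU scalerDr !(scale_algC _ (c ^+ l)); congr (_ + _ *: _).
  by rewrite !scalerA -(cD l).
(* Each c raises the index by 2, or by 3 with a factor D(0). What lands beyond n0 vanishes, and only
   steps by 2 can land on n0 itself. *)
have c0 l j : (n0 < j + l.*2)%N -> c ^+ l *: (X j *: v) = 0.
  elim: l j => [|l IH] j lt; first by rewrite n0max ?scaler0 //; lia.
  by rewrite cS !IH ?(scaler0, addr0) //; lia.
have ctop l j : (j + l.*2)%N = n0 ->
    c ^+ l *: (X j *: v) = (\prod_(t < l) C (n0 - t.+1.*2)%N)%:A *: u.
  elim: l j => [|l IH] j ej.
    by rewrite big_ord0 expr0 scale1r scale1r scale1r; congr (X _ *: _); lia.
  rewrite cS IH ?c0 ?(scaler0, addr0); [|lia|lia].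
  rewrite big_ord_recr /= scalerA mulr_algl scalerA mulrC.
  by congr ((_ * C _)%:A *: _); lia.
have := ctop N (n0 - N.*2)%N; rewrite subnK // hN scale0r => /(_ erefl) h0.
have {h0} : \prod_(t < N) C (n0 - t.+1.*2)%N == 0.
  by apply: contraT => C0; case: Xn0; exact: (alg_scaleI C0 (esym h0)).
move=> /prodf_eq0[t _ /eqP Ct]; apply/prodf_eq0; exists t => //.
apply/eqP; rewrite horner_Poly /= -[RHS]Ct /C natrB; last by have := ltn_ord t; lia.
by rewrite /e /f /z; ring.
Qed.

(** X(m+1) commutes with X(m), and ad X(m+1) sends D(0) to a nonzero multiple of X(m).
    Differentiating an integral equation of X(m) thus leaves a relation for X(m) alone, and the
    nonzero weight makes it nilpotent. *)
Lemma primary_nilpotent X s m : primary X s -> GRing.comm (X m) (X m.+1) ->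
  GRing.comm (X m) (D 0%N) -> s - m%:R * p != 0 -> nilpotent (X m).
Proof.
move=> hX XX XD w0; pose b := comr (X m.+1) (D 0%N).
have bE : b = (m.+1%:R * p) *: X m.
  by rewrite /b comrC (primary_comr0 _ hX) -scaleNr mulrN opprK.
have bc a : GRing.comm (X m) a -> GRing.comm b a.
  by rewrite bE /GRing.comm -scalerAl -scalerAr => ->.
have [|||||e [r [r0 hr]]] := @algebraic_of_relation (X m.+1) (X m) b 0 _ (erefl _).
- exact/comr_comm/commr_sym.
- by rewrite scale0r comr_comm //; apply/commr_sym/bc.
- exact: bc.
- exact: bc.
- by [].
apply: (eigen_relation_nilpotent (primary_weight m hX) w0 (r := 'X^e * r)).
  by rewrite mulf_neq0 // monic_neq0 ?monicXn.
move: hr; rewrite bE exprZn -scalerAl rmorphM rmorphXn /= horner_algX => /eqP.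
by rewrite scaler_eq0 expf_eq0 mulf_eq0 pnatr_eq0 (negbTE p0) andbF => /eqP.
Qed.

(** One mode is nilpotent by [primary_nilpotent], and ad D(r) transports nilpotency to the others.
    Commuting nilpotent operators, all but finitely many of which kill a given vector, have a common
    kernel vector. *)
Theorem commuting_kernel X s : primary X s ->
  (forall m n, GRing.comm (X m) (X n)) -> locally_finite X ->
  s != 0 \/ X 0%N = 0 -> exists2 v : V, v <> 0 & forall n, X n *: v = 0.
Proof.
move=> hX XX fX hs.
have cZ (a b : A) (k : K) : GRing.comm a b -> GRing.comm a (k *: b).
  by rewrite /GRing.comm -scalerAl -scalerAr => ->.
have nil r m : nilpotent (X m) -> r%:R * s - m%:R * p != 0 -> nilpotent (X (r + m).-1).
  move=> nm c0; have bE := hX r m.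
  have [|||k bk] := nilpotent_comr bE _ _ _ nm.
  - exact: cZ.
  - by rewrite linearZ /= hX; apply/cZ/cZ/XX.
  - by rewrite linearZ /= hX; apply/cZ/cZ/commr_sym/cZ/XX.
  exists k; move: bk; rewrite exprZn => /eqP.
  by rewrite scaler_eq0 expf_eq0 (negbTE c0) andbF => /eqP.
have allnil n : nilpotent (X n).
  have [s0|s0] := boolP (s != 0).
    have X0 : nilpotent (X 0%N).
      apply: (primary_nilpotent hX) => //; last by rewrite mul0r subr0.
      by apply/commr_sym/comm_comr; rewrite (primary_comr0 _ hX) mul0r scale0r.
    have := nil n.+1 0%N X0; rewrite addn0 /=; apply.
    by rewrite mul0r subr0 mulf_neq0 ?pnatr_eq0.
  have X0 : X 0%N = 0 by case: hs => // h; rewrite h in s0.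
  move: s0; rewrite negbK => /eqP s0.
  have [Xn|Xn] := eqVneq (X n) 0; first by exists 1%N; rewrite expr1.
  (* The first nonzero mode commutes with D(0), since ad D(0) sends it to a multiple of the
     preceding one. *)
  have [m Xm mmin] := ex_minnP (ex_intro (fun n => X n != 0) n Xn).
  case: m Xm mmin => [|m] Xm mmin; first by rewrite X0 eqxx in Xm.
  have w0 : s - m.+1%:R * p != 0.
    by rewrite s0 sub0r oppr_eq0 mulf_eq0 pnatr_eq0.
  have Xm0 : X m = 0.
    by apply/eqP; apply: contraT => /mmin; rewrite ltnn.
  have nm : nilpotent (X m.+1).
    apply: (primary_nilpotent hX) => //.
    by apply/commr_sym/comm_comr; rewrite (primary_comr0 _ hX) Xm0 scaler0.
  have := nil (n - m)%N m.+1 nm; have := mmin n Xn => lt.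
  have -> : ((n - m) + m.+1).-1 = n by lia.
  by apply; rewrite s0 mulr0 sub0r oppr_eq0 mulf_eq0 pnatr_eq0.
have [v0 v00] := V_neq0; have [M hM] := fX v0.
elim: M v0 v00 hM => [|M IH] v v0 hM; first by exists v => // n; exact: hM.
have [k hk] := allnil M.
have [||||w [Yw w0 Mw]] := @nilpotent_kernel _ A V (fun w => forall n, (M < n)%N -> X n *: w =
  0) (X M) v k.
- by move=> w Yw n Mn; rewrite scalerA XX -scalerA Yw ?scaler0.
- exact: hM.
- exact: v0.
- by rewrite hk scale0r.
apply: (IH w w0) => n; rewrite leq_eqVlt => /orP[/eqP <-//|]; exact: Yw.
Qed.

End Virasoro.

(** * The operators L_i and W_i *)

Lemma eventually_nonroot (K : numClosedFieldType) (B : {poly K}) (a : K) : B != 0 ->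
  exists I : nat, forall i, (I <= i)%N -> ~~ root B (i%:R + a).
Proof.
move=> B0; have [rs Brs] := closed_field_poly_normal B.
have [I hI] : exists I : nat, forall i, (I <= i)%N -> i%:R + a \notin rs.
  elim: rs {Brs} => [|z rs [I hI]]; first by exists 0%N.
  have [[i0 hi0]|no] := pselect (exists i0 : nat, i0%:R + a = z).
    exists (maxn I i0.+1) => i; rewrite geq_max => /andP[/hI hi lt].
    rewrite inE negb_or hi andbT -hi0 (inj_eq (addIr a)) eqr_nat.
    by rewrite neq_ltn lt orbT.
  exists I => i /hI hi; rewrite inE negb_or hi andbT.
  by apply/eqP => h; apply: no; exists i.
exists I => i /hI; rewrite Brs rootE hornerZ mulf_eq0 lead_coef_eq0 (negbTE B0) /=.
by rewrite -rootE root_prod_XsubC.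
Qed.

Lemma horner_alg_eval0 (K : fieldType) (A : algType K) (x S : A) (P : {poly {poly K}}) :
  GRing.comm x S -> exists Z : A, (map_poly (horner_alg x) P).[S] =
    horner_alg S (map_poly (horner_eval 0) P) + x * Z.
Proof.
move=> xS; elim/poly_ind: P => [|P c [Z hZ]].
  by exists 0; rewrite !rmorph0 horner0 mulr0 addr0.
have [c' hc] : exists c', c = c' * 'X + (c.[0])%:P.
  elim/poly_ind: c => [|c k _]; first by exists 0; rewrite horner0 mul0r addr0.
  by exists c; rewrite hornerMXaddC mulr0 add0r.
exists (Z * S + horner_alg x c').
rewrite !(rmorphD, rmorphM) /= !map_polyX !map_polyC /= hornerMXaddC hZ /horner_eval.
rewrite [in LHS]hc rmorphD rmorphM /= !horner_algX !horner_algC mulrDl mulrDr.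
rewrite [LHS](AC (2*2) ((1*4)*(2*3))) /= mulrA; congr (_ + (_ + _)).
by apply/commr_sym/horner_alg_comm.
Qed.

Lemma nilpotent_comr_scalar (K : numClosedFieldType) (A : algType K) (E a : A) (k : K) :
  nilpotent a -> comr E a = k%:A -> k = 0.
Proof.
move=> na hE; apply/eqP; apply: contraT => k0.
have cA (b : A) (l : K) : GRing.comm b l%:A by rewrite /GRing.comm mulr_algl mulr_algr.
have E0 : comr E k%:A = 0 by exact: comr_comm.
have [n] : nilpotent (k%:A : A).
  by apply: (nilpotent_comr hE _ _ _ na); rewrite ?E0 //; exact: commr0.
by rewrite exprZn expr1n => /eqP; rewrite scaler_eq0 expf_eq0 (negbTE k0) andbF oner_eq0.
Qed.

(** * Schur's lemma and the vanishing of currents on an irreducible module *)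

Section Block.
Variables (K : numClosedFieldType) (A : algType K) (V : lmodType A).
Variables (p alpha beta : K) (x : A) (L W : nat -> nat -> A).
Hypothesis p0 : p != 0.
Hypothesis LL : forall i j m n, comr (L i m) (L j n) =
  (m%:R * (j%:R + p) - n%:R * (i%:R + p)) *: L (i + j)%N (m + n).-1.
Hypothesis LW : forall i j m n, comr (L i m) (W j n) =
  (m%:R * (j%:R + alpha - p) - n%:R * (i%:R + p)) *: W (i + j)%N (m + n).-1
  + ((i%:R + p) * beta) *: W (i + j)%N (m + n)%N.
Hypothesis WW : forall i j m n, GRing.comm (W i m) (W j n).
Hypothesis Lx : forall i m, comr (L i m) x = m%:R *: L i m.-1.
Hypothesis Wx : forall i m, comr (W i m) x = m%:R *: W i m.-1.
Hypothesis x_integral : forall T : A, GRing.comm T x ->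
  exists2 P, P \is monic & (map_poly (horner_alg x) P).[T] = 0.
Hypothesis x_torsion_free : forall (f : {poly K}) (v : V),
  f != 0 -> horner_alg x f *: v = 0 -> v = 0.
Hypothesis x_not_surjective : ~ forall v : V, exists w, v = x *: w.
Hypothesis V_faithful : forall a : A, (forall v : V, a *: v = 0) -> a = 0.
Hypothesis L_finite : forall i, locally_finite V (L i).
Hypothesis W_finite : forall i, locally_finite V (W i).

Definition stable (N : V -> Prop) :=
  [/\ forall v, N v -> N (x *: v), forall i m v, N v -> N (L i m *: v) &
      forall i m v, N v -> N (W i m *: v)].

Hypothesis V_irreducible : forall N : V -> Prop, N 0 ->
  (forall (k : K) u w, N u -> N w -> N (k%:A *: u + w)) -> stable N ->
  (forall v, N v -> v = 0) \/ (forall v, N v).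

Lemma block_neq0 : exists v : V, v <> 0.
Proof.
apply: contrapT => h; apply: x_not_surjective => v; exists 0.
by rewrite scaler0; apply: contrapT => v0; apply: h; exists v.
Qed.

(** The common kernel is a nonzero submodule, hence all of V, and V is faithful. *)
Lemma kernel_submodule (P : A -> Prop) :
  (forall a (v : V), P a -> (forall b, P b -> b *: v = 0) ->
    [/\ comr a x *: v = 0, forall i m, comr a (L i m) *: v = 0 &
        forall i m, comr a (W i m) *: v = 0]) ->
  (exists2 v : V, v <> 0 & forall b, P b -> b *: v = 0) ->
  forall a, P a -> a = 0.
Proof.
move=> hP [v v0 Pv] a Pa; apply: V_faithful => w.
have [|k u u' hu hu' b Pb||/(_ v Pv)//|/(_ w)/(_ a Pa)//] :=
    V_irreducible (N := fun w => forall b, P b -> b *: w = 0).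
- by move=> b _; rewrite scaler0.
- by rewrite scalerDr scale_algC hu // hu' // scaler0 addr0.
- split=> [u hu b Pb|i m u hu b Pb|i m u hu b Pb]; rewrite comr_scale hu // scaler0 add0r;
    by have [] := hP b u Pb hu.
Qed.

(** Let P be an integral equation of S. If every S - c were onto, so would be P(0, S), a product of
    such factors; but its image lies in xV, which is not V. So some S - c has a proper image, a
    submodule, which is therefore 0. *)
Lemma schur (S : A) : GRing.comm S x -> (forall i m, GRing.comm S (L i m)) ->
  (forall i m, GRing.comm S (W i m)) -> exists c : K, S = c%:A.
Proof.
move=> Sx SL SW.
suff [c hc] : exists c : K, ~ forall v : V, exists w, v = (S - c%:A) *: w.
  have cA (b : A) (l : K) : GRing.comm b l%:A by rewrite /GRing.comm mulr_algl mulr_algr.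
  have cS b : GRing.comm S b -> GRing.comm b (S - c%:A).
    by move=> Sb; apply: commrB => //; apply: commr_sym.
  exists c; apply/eqP; rewrite -subr_eq0; apply/eqP; apply: V_faithful => v.
  have [||||] := V_irreducible (N := fun u => exists w, u = (S - c%:A) *: w).
  - by exists 0; rewrite scaler0.
  - by move=> k _ _ [w ->] [w' ->]; exists (k%:A *: w + w'); rewrite scalerDr scale_algC.
  - split=> [_ [w ->]|i m _ [w ->]|i m _ [w ->]].
    + by exists (x *: w); rewrite !scalerA (cS x).
    + by exists (L i m *: w); rewrite !scalerA (cS (L i m)).
    + by exists (W i m *: w); rewrite !scalerA (cS (W i m)).
  - by move=> h; apply: h; exists v.
  - by move=> h; case: hc.
apply: contrapT => no; have sur c : forall v : V, exists w, v = (S - c%:A) *: w.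
  by apply: contrapT => h; apply: no; exists c.
have [P Pm hP] := x_integral Sx.
have [Z] := horner_alg_eval0 P (commr_sym Sx); rewrite hP => hZ.
have [rs] := closed_field_poly_normal (map_poly (horner_eval 0) P).
rewrite (monicP (monic_map _ Pm)) scale1r => hrs; rewrite hrs in hZ.
apply: x_not_surjective => v.
have [w ->] : exists w, v = horner_alg S (\prod_(z <- rs) ('X - z%:P)) *: w.
  elim: rs {hrs hZ} v => [|z rs IH] v; first by exists v; rewrite big_nil rmorph1 scale1r.
  have [w hw] := sur z v; have [w' hw'] := IH w; exists w'.
  by rewrite big_cons rmorphM -scalerA -hw' rmorphB /= horner_algX horner_algC.
exists (- (Z *: w)); rewrite scalerN scalerA; apply/eqP; rewrite -addr_eq0 -scalerDl -hZ.
by rewrite scale0r.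
Qed.

Lemma L0_comm_x : GRing.comm (L 0 0) x.
Proof. by apply: comm_comr; rewrite Lx scale0r. Qed.

(* T = p∂ - L_0(0), which commutes with ∂ and with all the L_i(m), and shifts
   its eigenvalues through W_j(n). *)
Let T := p *: x - L 0 0.

Lemma T_comm_x : GRing.comm T x.
Proof.
apply/commr_sym/comm_comr; rewrite linearB linearZ /=.
rewrite [comr x x]comr_comm // scaler0 sub0r comrC opprK.
by rewrite comr_comm //; exact: L0_comm_x.
Qed.

Lemma T_comm_L i m : GRing.comm T (L i m).
Proof.
apply/commr_sym/comm_comr; rewrite linearB linearZ /= Lx LL addn0 addn0.
by rewrite scalerA -scalerBl (_ : _ - _ = 0) ?scale0r //; ring.
Qed.

Lemma comr_TW j n : comr T (W j n) = - (p * beta) *: W j n.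
Proof.
rewrite comrC [comr _ _]linearB /= linearZ /= Wx [comr _ (L 0 0)]comrC LW !add0n opprK addrA.
rewrite scalerA -scalerDl (_ : p * n%:R + _ = 0) ?scale0r ?add0r; last by ring.
by rewrite scaleNr.
Qed.

(** If T has an eigenvalue, the shift by - p β and the finiteness of the set of eigenvalues give an
    eigenvector killed by all the W. If it has none, L_0(0) is nilpotent, while W_j(n) would produce
    eigenvectors of L_0(0) with eigenvalue p β. *)
Lemma W_trivial : beta != 0 -> forall j n, W j n = 0.
Proof.
move=> b0; pose E (c : K) := exists2 w : V, w <> 0 & T *: w = c%:A *: w.
have pb0 : p * beta != 0 by rewrite mulf_neq0.
have kerW a (v : V) : (exists i m, a = W i m) ->
    (forall b, (exists i m, b = W i m) -> b *: v = 0) ->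
    [/\ comr a x *: v = 0, forall i m, comr a (L i m) *: v = 0 &
        forall i m, comr a (W i m) *: v = 0].
  move=> [i [m ->]] hv; have W0 i' m' : W i' m' *: v = 0 by apply: hv; exists i', m'.
  split=> [|i' m'|i' m'].
  - by rewrite Wx scale_alg W0 scaler0.
  - by rewrite comrC LW scaleNr (scalerDl v) scale_alg [X in _ + X]scale_alg !W0 !scaler0 addr0
    oppr0.
  - by rewrite comr_comm ?scale0r.
have [[c Ec]|noE] := pselect (exists c, E c).
  have [P Pm hP] := x_integral T_comm_x.
  have rootP c' : E c' -> root P c'%:P.
    move=> [w w0 Tw]; apply: contraT; rewrite rootE => Pc; case: w0.
    apply: (x_torsion_free Pc); rewrite -[RHS](scale0r w) -hP.
    elim/poly_ind: P {Pm hP Pc} => [|P q IH]; first by rewrite !rmorph0 !horner0 rmorph0.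
    rewrite hornerMXaddC !(rmorphD, rmorphM) /= horner_algC map_polyX map_polyC hornerMXaddC /=.
    by rewrite !scalerDl -!scalerA Tw [in RHS](scale_algC c' _.[T]) -IH scale_algC.
  (* Otherwise the progression c - k p β would give P more roots than its degree allows. *)
  have [k Ek nEk] : exists2 k : nat, E (c - k%:R * (p * beta)) & ~ E (c - k.+1%:R * (p * beta)).
    apply: contrapT => no.
    have allE k : E (c - k%:R * (p * beta)).
      elim: k => [|k IH]; first by rewrite mul0r subr0.
      by apply: contrapT => nE; apply: no; exists k.
    pose rs := [seq (c - k%:R * (p * beta))%:P | k <- iota 0 (size P)].
    have := @max_poly_roots _ P rs (monic_neq0 Pm).
    rewrite size_map size_iota ltnn => h; suff : false by []; apply: h.
      by apply/allP => _ /mapP[k _ ->]; exact: rootP.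
    rewrite map_inj_uniq ?iota_uniq // => k l /polyC_inj /addrI /oppr_inj.
    by move/(mulIf pb0)/eqP; rewrite eqr_nat => /eqP.
  have [w w0 Tw] := Ek.
  have Ww j n : W j n *: w = 0.
    apply: contrapT => Ww; apply: nEk; exists (W j n *: w) => //.
    rewrite comr_scale Tw scale_algC comr_TW [X in _ + X]scale_alg -scalerDl -scalerDl.
    by congr (_%:A *: _); rewrite -natr1; ring.
  move=> j n; apply: (kernel_submodule kerW); last by exists j, n.
  by exists w => // _ [i [m ->]].
have D10 : comr (L 0 1%N) (L 0 0) = p *: L 0 0.
  by rewrite LL; congr (_ *: _); ring.
have Tw0 : GRing.comm (L 0 0) T by apply/commr_sym/T_comm_L.
have [P Pm hP] := x_integral T_comm_x.
(* ad L_0(1) kills T and sends x to L_0(0), whence L_0(0)^e r(T) = 0; without eigenvalues r(T) is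
   injective. *)
have [||e [r [r0 hr]]] := @comr_relation _ _ (L 0 1%N) x T (L 0 0) p P _ _ D10 L0_comm_x Tw0
  T_comm_x (monic_neq0 Pm) hP.
- by apply/comr_comm/commr_sym/T_comm_L.
- by rewrite Lx scale1r.
have y0 (v : V) : L 0 0 ^+ e *: v = 0.
  apply: contrapT => ye; have cr : GRing.comm (L 0 0 ^+ e) (horner_alg T r).
    by apply/commr_sym/commrX/commr_sym/horner_alg_comm.
  have [||||w [h [_ w0 hw]]] := @polynomial_eigenvector _ _ V (fun _ => True) T _ r _ _ _ I ye
    r0.
  - by [].
  - by [].
  - by [].
  - by rewrite scalerA -cr hr scale0r.
  by apply: noE; exists h, w.
have yW j n (v : V) : (forall m, (m < n)%N -> forall v : V, W j m *: v = 0) ->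
    comr (L 0 0) (W j n) *: v = (p * beta)%:A *: (W j n *: v).
  move=> IH; rewrite LW !add0n (scalerDl v) scale_alg [X in _ + X]scale_alg.
  rewrite [X in X + _](_ : _ = 0); first by rewrite add0r; congr (_%:A *: _); ring.
  case: n IH => [|n] IH; last by rewrite IH ?scaler0.
  by rewrite !mul0r subr0 scale0r scale0r.
move=> j n; apply: V_faithful; have [n' lt] := ubnP n; elim: n' n lt => // n' IHn n lt v.
(* W_j(n) kills the kernel of L_0(0)^k, by induction on k; for k = e this kernel is V. *)
suff yk k : forall v : V, L 0 0 ^+ k *: v = 0 -> W j n *: v = 0 by exact: yk (y0 v).
have {}yW (u : V) : comr (L 0 0) (W j n) *: u = (p * beta)%:A *: (W j n *: u).
  by apply: yW => m lm; apply: IHn; apply: leq_trans lm _.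
elim: k => [|k IH] u; first by rewrite expr0 scale1r => ->; rewrite scaler0.
rewrite exprSr -scalerA => /IH Wy.
have yWu : L 0 0 *: (W j n *: u) = (p * beta)%:A *: (W j n *: u).
  by rewrite comr_scale Wy add0r yW.
have : L 0 0 ^+ e *: (W j n *: u) = ((p * beta) ^+ e)%:A *: (W j n *: u).
  by have := horner_alg_eigen 'X^e yWu; rewrite rmorphXn /= horner_algX hornerXn.
by rewrite y0 => /esym/alg_scaleI; apply; rewrite expf_neq0.
Qed.

(** For β = 0 and for W = 0 alike, the inhomogeneous term of [L, W] disappears, and each W_j becomes
    primary for L_0. *)
Lemma betaW j n : beta *: W j n = 0.
Proof.
have [->|b0] := eqVneq beta 0; first by rewrite scale0r.
by rewrite W_trivial ?scaler0.
Qed.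

Lemma comr_LW i j m n : comr (L i m) (W j n) =
  (m%:R * (j%:R + alpha - p) - n%:R * (i%:R + p)) *: W (i + j)%N (m + n).-1.
Proof. by rewrite LW -[X in _ + X]scalerA betaW scaler0 addr0. Qed.

(** T now commutes with the W as well, so it is a scalar. Integrality and torsion-freeness over C[x]
    thereby pass to C[L_0(0)]. *)
Lemma x_of_L0 : exists c : K, p *: x = L 0 0 + c%:A.
Proof.
have [|||c hc] := @schur T; last by exists c; rewrite -hc addrC subrK.
- exact: T_comm_x.
- exact: T_comm_L.
- by move=> i m; apply: comm_comr; rewrite comr_TW -mulNr -scalerA betaW scaler0.
Qed.

Lemma L0_comm S : GRing.comm S (L 0 0) <-> GRing.comm S x.
Proof.
have [c hc] := x_of_L0; split=> h.
  have -> : x = p^-1 *: (L 0 0 + c%:A) by rewrite -hc scalerA mulVf ?scale1r.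
  rewrite /GRing.comm -scalerAl -scalerAr mulrDl mulrDr h.
  by rewrite mulr_algl mulr_algr.
have -> : L 0 0 = p *: x - c%:A by rewrite hc addrK.
by rewrite /GRing.comm mulrBl mulrBr mulr_algl mulr_algr -scalerAl -scalerAr h.
Qed.

Lemma L0_integral S : GRing.comm S (L 0 0) ->
  exists2 P, P \is monic & (map_poly (horner_alg (L 0 0)) P).[S] = 0.
Proof.
move=> /L0_comm/x_integral[P Pm hP]; have [c hc] := x_of_L0.
pose q := p^-1 *: ('X + c%:P).
exists (map_poly (comp_poly q) P); first exact: monic_map.
rewrite -map_poly_comp /= (eq_map_poly (g := horner_alg x)) // => r /=.
rewrite horner_alg_comp /q linearZ /= rmorphD /= horner_algX horner_algC -hc.
by rewrite mulr_algl scalerA mulVf ?scale1r.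
Qed.

Lemma L0_inj v : L 0 0 *: v = 0 -> v = 0 :> V.
Proof.
have [c hc] := x_of_L0; have -> : L 0 0 = horner_alg x (p *: 'X - c%:P).
  by rewrite rmorphB /= linearZ /= horner_algX horner_algC mulr_algl hc addrK.
apply: x_torsion_free; apply: contraNneq p0 => /(congr1 (fun r : {poly K} => r`_1)).
by rewrite coefB coefZ coefX coefC coef0 mulr1 subr0 => ->.
Qed.

Lemma comr_L0 m n : comr (L 0 m) (L 0 n) = ((m%:R - n%:R) * p) *: L 0 (m + n).-1.
Proof. by rewrite LL; congr (_ *: _); ring. Qed.

Lemma primary_L i : primary p (L 0) (L i) (i%:R + p).
Proof. by move=> m n; rewrite LL add0r. Qed.

Lemma primary_W j : primary p (L 0) (W j) (j%:R + alpha - p).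
Proof. by move=> m n; rewrite comr_LW add0r. Qed.

(** L_i and W_i are primary for L_0 with s = i + p and s = i + α - p, which for large i avoid the
    roots of the polynomial from [primary_types_acting]. They then kill a fixed vector, and together
    they span an ideal. *)
Lemma eventually_trivial : exists I, forall i, (I <= i)%N ->
  (forall n, L i n = 0) /\ (forall n, W i n = 0).
Proof.
have [v [h [v0 Dv D1v _]]] := singular_vector p0 comr_L0 L0_integral L0_inj V_faithful
  block_neq0 (L_finite 0) (X := fun (_ : void) _ => 0)
  (fun j => match j with end) (fun j => match j with end) (fun j => match j with end).
have [B B0 hB] := primary_types_acting p0 comr_L0 L0_integral L0_inj V_faithful v0 Dv D1v.
have [I1 h1] := eventually_nonroot p B0.
have [I2 h2] := eventually_nonroot (alpha - p) B0.
exists (maxn I1 I2); pose P a := exists i m, (maxn I1 I2 <= i)%N /\ (a = L i m \/ a = W i m).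
have Pv b : P b -> b *: v = 0.
  move=> [i [m []]]; rewrite geq_max => /andP[/h1 r1 /h2 r2] bE; apply: contrapT => bv.
  case: bE bv => ->.
    move=> bv; move: r1; rewrite (hB _ _ (primary_L i) (L_finite i)) //; by exists m.
  move=> bv; move: r2; rewrite addrA (hB _ _ (primary_W i) (W_finite i)) //; by exists m.
suff hP a : P a -> a = 0.
  by move=> i iI; split=> n; apply: hP; exists i, n; split=> //; [left|right].
move=> Pa; apply: (kernel_submodule _ _ Pa); last by exists v.
move=> {a Pa}a w [i [m [iI aE]]] hw.
have L0 i' m' : (maxn I1 I2 <= i')%N -> L i' m' *: w = 0.
  by move=> h'; apply: hw; exists i', m'; split=> //; left.
have W0 i' m' : (maxn I1 I2 <= i')%N -> W i' m' *: w = 0.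
  by move=> h'; apply: hw; exists i', m'; split=> //; right.
case: aE => ->; split=> [|i' m'|i' m'].
- by rewrite Lx scale_alg L0 ?scaler0.
- by rewrite LL scale_alg L0 ?scaler0 // (leq_trans iI) ?leq_addr.
- by rewrite comr_LW scale_alg W0 ?scaler0 // (leq_trans iI) ?leq_addr.
- by rewrite Wx scale_alg W0 ?scaler0.
- by rewrite comrC comr_LW -scaleNr scale_alg W0 ?scaler0 // (leq_trans iI) ?leq_addl.
- by rewrite comr_comm ?scale0r.
Qed.

(* The top nonzero family spans an abelian ideal; either its common kernel is a
   nonzero submodule, or its zero mode is a scalar by Schur's lemma. *)
Lemma top_current X s : primary p (L 0) X s -> (forall m n, GRing.comm (X m) (X n)) ->
  locally_finite V X ->
  (forall m, exists k l, comr (X m) x = k *: X l) ->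
  (forall i m n, exists k l, comr (X m) (L i n) = k *: X l) ->
  (forall i m n, exists k l, comr (X m) (W i n) = k *: X l) ->
  (s = 0 -> (forall i m, GRing.comm (X 0%N) (L i m)) /\ (forall i m, GRing.comm (X 0%N) (W i
    m))) ->
  (forall n, X n = 0) \/ (s = 0 /\ exists2 c : K, c != 0 & X 0%N = c%:A).
Proof.
move=> hX XX fX Xx XL XW Xs.
have triv : s != 0 \/ X 0%N = 0 -> forall n, X n = 0.
  move=> hs; have [v v0 Xv] := commuting_kernel p0 L0_integral block_neq0 hX XX fX hs.
  move=> n; apply: (@kernel_submodule (fun a => exists n, a = X n)); last by exists n.
    move=> _ w [m ->] hw; have Xw k l : (k *: X l) *: w = 0.
      by rewrite scale_alg hw ?scaler0 //; exists l.
    split=> [|i n'|i n'].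
    - by have [k [l ->]] := Xx m.
    - by have [k [l ->]] := XL i m n'.
    - by have [k [l ->]] := XW i m n'.
  by exists v => // _ [m ->].
have [s0|s0] := eqVneq s 0; last by left; apply: triv; left.
have [hL hW] := Xs s0.
have [|//|//|c hc] := @schur (X 0%N).
  by apply/L0_comm/commr_sym/comm_comr; rewrite hX mul0r sub0r mul0r oppr0 scale0r.
have [c0|c0] := eqVneq c 0; last by right; split=> //; exists c.
by left; apply: triv; right; rewrite hc c0 scale0r.
Qed.

Lemma W_top k : (forall i n, (k < i)%N -> W i n = 0) ->
  (forall n, W k n = 0) \/
  (k%:R + alpha - p = 0 /\ exists2 c : K, c != 0 & W k 0 = c%:A).
Proof.
move=> W0; apply: (top_current (primary_W k)) => //.
- by move=> m; rewrite Wx; eexists; eexists.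
- move=> i m n; case: i => [|i].
    by rewrite comrC comr_LW -scaleNr add0n; eexists; eexists.
  by exists 0, 0%N; rewrite comrC comr_LW W0 ?scaler0 ?oppr0 ?scale0r //; lia.
- by move=> i m n; exists 0, 0%N; rewrite scale0r comr_comm.
- move=> s0; split=> // i m; apply/commr_sym/comm_comr.
  by rewrite comr_LW s0 mulr0 mul0r subr0 scale0r.
Qed.

(** Downward induction on k. If W_k(0) were a nonzero scalar, W_(k-1)(0) would have weight -1, hence
    be nilpotent, yet its commutator with L_1(1) would be the nonzero scalar - W_k(0). *)
Lemma W_positive k n : (0 < k)%N -> W k n = 0.
Proof.
have [I hI] := eventually_trivial.
have [d] := ubnP (I - k)%N; elim: d k n => // d IH k n lt k0.
have [Ik|kI] := leqP I k; first by case: (hI k Ik).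
have [|-> //|[s0 [c c0 hc]]] := @W_top k.
  by move=> i m ki; apply: IH; lia.
have na : nilpotent (W k.-1 0).
  apply: (primary_nilpotent p0 L0_integral (primary_W k.-1)) => //.
    by apply/commr_sym/comm_comr; rewrite comr_LW !mul0r subr0 scale0r.
  rewrite mul0r subr0 (_ : _ - _ = -1) ?oppr_eq0 ?oner_eq0 //.
  by rewrite -[RHS](add0r (-1)) -s0 -{2}(prednK k0) -natr1; ring.
have := @nilpotent_comr_scalar _ _ (L 1 1%N) _ (- c) na.
rewrite comr_LW add1n prednK // hc scalerA mul1r mul0r subr0 => h.
suff /eqP : - c = 0 by rewrite oppr_eq0 (negbTE c0).
apply: h; congr (_ *: _); rewrite -[RHS]mulN1r; congr (_ * _).
by rewrite -[RHS](add0r (-1)) -s0 -{2}(prednK k0) -natr1; ring.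
Qed.

Lemma L_top k : (0 < k)%N -> (forall i n, (k < i)%N -> L i n = 0) ->
  (forall n, L k n = 0) \/ (k%:R + p = 0 /\ exists2 c : K, c != 0 & L k 0 = c%:A).
Proof.
move=> k0 L0; apply: (top_current (primary_L k)) => //.
- by move=> m n; apply: comm_comr; rewrite LL L0 ?scaler0 //; lia.
- by move=> m; rewrite Lx; eexists; eexists.
- move=> i m n; case: i => [|i].
    by rewrite LL addn0; eexists; eexists.
  by exists 0, 0%N; rewrite LL L0 ?scaler0 ?scale0r //; lia.
- by move=> i m n; exists 0, 0%N; rewrite comr_LW W_positive ?scaler0 ?scale0r // addn_gt0 k0.
- move=> s0; split=> i m; apply/commr_sym/comm_comr.
    by rewrite LL s0 mulr0 mul0r subr0 scale0r.
  by rewrite comrC comr_LW W_positive ?scaler0 ?oppr0 // addn_gt0 k0.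
Qed.

(** Downward induction on k. If L_k(0) is a nonzero scalar, then p = - k, and ad L_k(1) kills L_1(0)
    and sends L_0(0) to a nonzero scalar. So L_1(0) is algebraic, and nilpotent as its weight 1 + p
    is nonzero; but [L_(k-1)(1), L_1(0)] = (1 + p) L_k(0) is a nonzero scalar. *)
Lemma L_ge2 k n : (1 < k)%N -> L k n = 0.
Proof.
have [I hI] := eventually_trivial.
have [d] := ubnP (I - k)%N; elim: d k n => // d IH k n lt k1.
have [Ik|kI] := leqP I k; first by case: (hI k Ik).
have L0 i m : (k < i)%N -> L i m = 0 by move=> ki; apply: IH; lia.
have [-> //|[s0 [c c0 hc]]] := L_top (ltnW k1) L0.
have pE : p = - k%:R by apply/eqP; rewrite -addr_eq0 addrC s0.
have p1 : 1 + p != 0.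
  by rewrite pE -(prednK (ltnW k1)) -natr1 opprD addrCA subrr addr0 oppr_eq0 pnatr_eq0; lia.
pose b := comr (L k 1%N) (L 0 0).
have bE : b = (p * c)%:A.
  by rewrite /b LL addn0 hc scalerA; congr (_ *: _); ring.
have cA (a : A) (l : K) : GRing.comm l%:A a by rewrite /GRing.comm mulr_algl mulr_algr.
have L1y : GRing.comm (L 1%N 0) (L 0 0).
  by apply/commr_sym/comm_comr; rewrite LL !mul0r subr0 scale0r.
have [|||||e [r [r0 hr]]] := @algebraic_of_relation _ _ (L 0) L0_integral (L k 1%N) (L 1%N 0) b
  0 _ (erefl _).
- by rewrite LL L0 ?scaler0 // addn1.
- by rewrite bE scale0r comr_comm //; apply: commr_sym.
- by rewrite bE.
- by rewrite bE.
- exact: L1y.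
have na : nilpotent (L 1%N 0).
  apply: (@eigen_relation_nilpotent _ _ (L 0 1%N) _ (1 + p) r _ p1 r0).
    by rewrite LL; congr (_ *: _); ring.
  move: hr => /eqP; rewrite bE exprZn expr1n mulr_algl scaler_eq0 expf_eq0 mulf_eq0.
  by rewrite (negbTE p0) (negbTE c0) andbF => /eqP.
have := @nilpotent_comr_scalar _ _ (L k.-1 1%N) _ ((1 + p) * c) na.
rewrite LL addn1 prednK ?(ltnW k1) // hc scalerA mul1r mul0r subr0 => /(_ erefl) /eqP.
by rewrite mulf_eq0 (negbTE p1) (negbTE c0).
Qed.

(** The currents left besides L_0 are L_1 and W_0, with scalar zero modes. All modes send a common
    singular vector v into C[x]v, which is therefore a submodule. *)
Theorem cyclic_over_x : exists2 v : V, v <> 0 & forall w, exists f : {poly K}, w = horner_alg x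
  f *: v.
Proof.
pose X (b : bool) := if b then L 1 else W 0.
have XE b : primary p (L 0) (X b) 0 /\ exists c : K, X b 0%N = c%:A.
  (* A zero current is primary for every s, so s = 0 can be taken in both alternatives. *)
  have triv (Y : nat -> A) s : primary p (L 0) Y s ->
      (forall n, Y n = 0) \/ (s = 0 /\ exists2 c : K, c != 0 & Y 0%N = c%:A) ->
      primary p (L 0) Y 0 /\ exists c : K, Y 0%N = c%:A.
    move=> hY [Y0|[<- [c _ hc]]]; last by split=> //; exists c.
    split; last by exists 0; rewrite Y0 scale0r.
    by move=> m n; rewrite !Y0 linear0 scaler0.
  case: b; rewrite /X.
    by apply: (triv _ _ (primary_L 1)); apply: L_top => // i n; exact: L_ge2.
  by apply: (triv _ _ (primary_W 0)); apply: W_top => i n; exact: W_positive.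
have XX a b m n : GRing.comm (X a m) (X b n).
  case: a b => [] []; rewrite /X //.
  - by apply: comm_comr; rewrite LL L_ge2 ?scaler0.
  - by apply: comm_comr; rewrite comr_LW W_positive ?scaler0.
  - by apply/commr_sym/comm_comr; rewrite comr_LW W_positive ?scaler0.
have Xfin b : locally_finite V (X b) by case: b; [exact: L_finite|exact: W_finite].
have [v [h [v0 Dv D1v Xv]]] := singular_vector p0 comr_L0 L0_integral L0_inj V_faithful
  block_neq0 (L_finite 0) (fun b => (XE b).1) XX Xfin.
exists v => //; pose N w := exists f : {poly K}, w = horner_alg x f *: v.
have Nx w : N w -> N (x *: w).
  move=> [f ->]; exists ('X * f); by rewrite rmorphM /= horner_algX scalerA.
have ND (k : K) u w : N u -> N w -> N (k%:A *: u + w).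
  move=> [f ->] [g ->]; exists (k%:P * f + g).
  by rewrite rmorphD rmorphM /= horner_algC scalerDl scalerA.
have N0 : N 0 by exists 0; rewrite rmorph0 scale0r.
have Nv : N v by exists 1; rewrite rmorph1 scale1r.
have NZ (k : K) w : N w -> N (k%:A *: w) by move=> Nw; rewrite -[_ *: w]addr0; exact: ND.
(* Moving F(m) past x only costs F(m - 1), so the values on v suffice. *)
have key (F : nat -> A) : (forall m, comr (F m) x = m%:R *: F m.-1) ->
    (forall m, N (F m *: v)) -> forall m w, N w -> N (F m *: w).
  move=> Fx Fv m w [f ->]; elim/poly_ind: f m => [|f k IH] m.
    by rewrite rmorph0 scale0r scaler0.
  rewrite rmorphD mulrC rmorphM /= horner_algX horner_algC scalerDl scalerDr -scalerA addrC.
  rewrite scale_algC; apply: (ND) => //.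
  rewrite comr_scale Fx scale_alg addrC; apply: (ND) => //; exact: Nx.
have [c hc] := x_of_L0.
have [|||h0|hN w] := V_irreducible (N := N) => //; last by have [f ->] := hN w; exists f.
  split=> // i; apply: key => // m.
    case: i => [|[|i]]; last by rewrite L_ge2 ?scale0r.
      case: m => [|[|m]]; last by rewrite Dv.
        have -> : L 0 0 = p *: x - c%:A by rewrite hc addrK.
        by rewrite scalerBl scale_alg -scaleNr -scaleNr; apply: ND; [exact: Nx|exact: NZ].
      by rewrite D1v; exact: NZ.
    case: m => [|m]; last by rewrite (Xv true) // scale0r.
    by have [_ [c' hc']] := XE true; rewrite [L 1 0]hc'; exact: NZ.
  case: i => [|i]; last by rewrite W_positive ?scale0r.
  case: m => [|m]; last by rewrite (Xv false).
  by have [_ [c' hc']] := XE false; rewrite [W 0 0]hc'; exact: NZ.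
by case: v0; apply: h0.
Qed.

End Block.

(** * The algebra of endomorphisms *)

(** Linear over K only, because the modes do not commute with ∂. *)
Record endo_map (K : fieldType) (V : lmodType {poly K}) := EndoMap {
  endo_fun :> V -> V;
  endo_linear : forall (c : K) u v,
    endo_fun (c%:P *: u + v) = c%:P *: endo_fun u + endo_fun v
}.

(* The proof that V <> 0 makes the ring of K-linear endomorphisms nontrivial. *)
Definition endo (K : fieldType) (V : lmodType {poly K}) (h : exists v : V, v <> 0) : Type :=
  endo_map V.

(** A copy of V for the scaling by [endo h], kept apart from the scaling by polynomials. *)
Definition endo_module (K : fieldType) (V : lmodType {poly K}) (h : exists v : V, v <> 0) :
  Type :=
  V.

Section EndoRing.
Variables (K : fieldType) (V : lmodType {poly K}) (h : exists v : V, v <> 0).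
Implicit Types f g : endo h.

Lemma endoP f g : (forall v, f v = g v) -> f = g.
Proof.
case: f g => [f hf] [g hg] /= /funext fg; subst g.
by congr EndoMap; exact: Prop_irrelevance.
Qed.

Lemma endoD f u v : f (u + v) = f u + f v.
Proof. by have := endo_linear f 1 u v; rewrite polyC1 !scale1r. Qed.

Lemma endo0 f : f 0 = 0.
Proof. by apply: (addrI (f 0)); rewrite -endoD !addr0. Qed.

Lemma endoZ f (c : K) v : f (c%:P *: v) = c%:P *: f v.
Proof. by have := endo_linear f c v 0; rewrite endo0 !addr0. Qed.

Fact endo_zero_subproof (c : K) (u v : V) : 0 = c%:P *: 0 + 0 :> V.
Proof. by rewrite scaler0 addr0. Qed.
Definition endo_zero : endo h := EndoMap endo_zero_subproof.

Fact endo_one_subproof (c : K) (u v : V) : c%:P *: u + v = c%:P *: u + v.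
Proof. by []. Qed.
Definition endo_one : endo h := EndoMap endo_one_subproof.

Fact endo_add_subproof f g (c : K) u v :
  f (c%:P *: u + v) + g (c%:P *: u + v) = c%:P *: (f u + g u) + (f v + g v).
Proof. by rewrite !endo_linear scalerDr addrACA. Qed.
Definition endo_add f g : endo h := EndoMap (endo_add_subproof f g).

Fact endo_opp_subproof f (c : K) u v :
  - f (c%:P *: u + v) = c%:P *: (- f u) + (- f v).
Proof. by rewrite endo_linear opprD scalerN. Qed.
Definition endo_opp f : endo h := EndoMap (endo_opp_subproof f).

Fact endo_mul_subproof f g (c : K) u v :
  f (g (c%:P *: u + v)) = c%:P *: f (g u) + f (g v).
Proof. by rewrite !endo_linear. Qed.
Definition endo_mul f g : endo h := EndoMap (endo_mul_subproof f g).

Fact endo_scale_subproof (k : K) f (c : K) u v :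
  k%:P *: f (c%:P *: u + v) = c%:P *: (k%:P *: f u) + k%:P *: f v.
Proof. by rewrite endo_linear scalerDr !scalerA mulrC. Qed.
Definition endo_scale (k : K) f : endo h := EndoMap (endo_scale_subproof k f).

HB.instance Definition _ := gen_eqMixin (endo h).
HB.instance Definition _ := gen_choiceMixin (endo h).

Fact endo_addA : associative endo_add.
Proof. by move=> a b c; apply: endoP => v; exact: addrA. Qed.
Fact endo_addC : commutative endo_add.
Proof. by move=> a b; apply: endoP => v; exact: addrC. Qed.
Fact endo_add0 : left_id endo_zero endo_add.
Proof. by move=> a; apply: endoP => v; exact: add0r. Qed.
Fact endo_addN : left_inverse endo_zero endo_opp endo_add.
Proof. by move=> a; apply: endoP => v; exact: addNr. Qed.

HB.instance Definition _ := GRing.isZmodule.Build (endo h)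
  endo_addA endo_addC endo_add0 endo_addN.

Fact endo_mulA : associative endo_mul.
Proof. by move=> a b c; exact: endoP. Qed.
Fact endo_mul1 : left_id endo_one endo_mul.
Proof. by move=> a; exact: endoP. Qed.
Fact endo_mulr1 : right_id endo_one endo_mul.
Proof. by move=> a; exact: endoP. Qed.
Fact endo_mulDl : left_distributive endo_mul +%R.
Proof. by move=> a b c; exact: endoP. Qed.
Fact endo_mulDr : right_distributive endo_mul +%R.
Proof. by move=> a b c; apply: endoP => v; exact: endoD. Qed.
Fact endo_one_neq0 : endo_one != 0.
Proof.
apply/eqP => /(congr1 (fun f : endo h => endo_fun f)) e.
by case: h => v; apply; rewrite -[v]/(endo_one v) e.
Qed.

HB.instance Definition _ := GRing.Zmodule_isNzRing.Build (endo h)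
  endo_mulA endo_mul1 endo_mulr1 endo_mulDl endo_mulDr endo_one_neq0.

Fact endo_scaleA a b f : endo_scale a (endo_scale b f) = endo_scale (a * b) f.
Proof. by apply: endoP => v /=; rewrite scalerA polyCM. Qed.
Fact endo_scale1 : left_id 1 endo_scale.
Proof. by move=> f; apply: endoP => v /=; rewrite scale1r. Qed.
Fact endo_scaleDr : right_distributive endo_scale +%R.
Proof. by move=> a f g; apply: endoP => v; exact: scalerDr. Qed.
Fact endo_scaleDl f : {morph endo_scale^~ f : a b / a + b}.
Proof. by move=> a b; apply: endoP => v /=; rewrite polyCD scalerDl. Qed.

HB.instance Definition _ := GRing.Zmodule_isLmodule.Build K (endo h)
  endo_scaleA endo_scale1 endo_scaleDr endo_scaleDl.

Fact endo_scaleAl (k : K) f g : k *: (f * g) = (k *: f) * g.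
Proof. exact: endoP. Qed.
HB.instance Definition _ := GRing.Lmodule_isLalgebra.Build K (endo h) endo_scaleAl.

Fact endo_scaleAr (k : K) f g : k *: (f * g) = f * (k *: g).
Proof. by apply: endoP => v; rewrite [RHS]endoZ. Qed.
HB.instance Definition _ := GRing.Lalgebra_isAlgebra.Build K (endo h) endo_scaleAr.

HB.instance Definition _ := GRing.Zmodule.on (endo_module h).

Definition endo_apply (f : endo h) (v : endo_module h) : endo_module h := f v.

Fact endo_applyA a b v : endo_apply a (endo_apply b v) = endo_apply (a * b) v.
Proof. by []. Qed.
Fact endo_apply1 : left_id 1 endo_apply.
Proof. by []. Qed.
Fact endo_applyDr : right_distributive endo_apply +%R.
Proof. by move=> f u v; exact: endoD. Qed.
Fact endo_applyDl v : {morph endo_apply^~ v : a b / a + b}.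
Proof. by []. Qed.

HB.instance Definition _ := GRing.Zmodule_isLmodule.Build (endo h) (endo_module h)
  endo_applyA endo_apply1 endo_applyDr endo_applyDl.

Fact endoX_subproof (c : K) (u v : V) : 'X *: (c%:P *: u + v) = c%:P *: ('X *: u) + 'X *: v.
Proof. by rewrite scalerDr !scalerA mulrC. Qed.
Definition endoX : endo h := EndoMap endoX_subproof.

Lemma horner_endoX (f : {poly K}) (v : V) : (horner_alg endoX f : endo h) v = f *: v.
Proof.
elim/poly_ind: f v => [|f c IH] v; first by rewrite rmorph0 scale0r.
rewrite rmorphD rmorphM /= horner_algX horner_algC scalerDl -scalerA -IH.
by rewrite -[RHS]/(_ + _) -[c%:P *: v]/(endo_scale c 1 v).
Qed.

Lemma comm_endoX (T : endo h) : GRing.comm T endoX ->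
  forall (f : {poly K}) v, T (f *: v) = f *: T v.
Proof.
move=> TX f v; elim/poly_ind: f v => [|f c IH] v; first by rewrite !scale0r endo0.
rewrite !scalerDl -!scalerA endoD endoZ IH; congr (_ *: _ + _).
exact: (congr1 (fun g : endo h => g v) TX).
Qed.

End EndoRing.

(** * Conformal modules *)

Lemma spanning_ord (R : comNzRingType) (M : lmodType R) n (e : 'I_n -> M) :
  spanning e -> forall v, exists f : 'I_n -> R, v = \sum_i f i *: e i.
Proof.
move=> he v; have [s [f ->]] := he v; elim: s => [|i s [g hg]].
  by exists (fun _ => 0); rewrite big_nil big1 // => i _; rewrite scale0r.
exists (fun j => (if j == i then f i else 0) + g j).
rewrite big_cons hg; under [in RHS]eq_bigr do rewrite scalerDl.
rewrite big_split /=; congr (_ + _); rewrite (bigD1 i) //= eqxx big1 ?addr0 //.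
by move=> j /negbTE ->; rewrite scale0r.
Qed.

(** * Determinant arguments for finitely generated modules *)

Section FinitelyGenerated.
Variables (K : fieldType) (V : lmodType {poly K}) (h : exists v : V, v <> 0).
Hypothesis V_finite : finitely_generated V.

Lemma fg_generators : exists n (e : 'I_n.+1 -> V),
  forall v, exists f : 'I_n.+1 -> {poly K}, v = \sum_i f i *: e i.
Proof.
have [[|n] [e /spanning_ord he]] := V_finite; last by exists n, e.
by have [v v0] := h; have [f] := he v; rewrite big_ord0 => /v0.
Qed.

(** Cayley-Hamilton for a matrix of T on generators. These need not be independent: a polynomial in
    the matrix still describes the same polynomial in T on them. *)
Lemma endoX_integral (T : endo h) : GRing.comm T (endoX h) ->
  exists2 P, P \is monic & (map_poly (horner_alg (endoX h)) P).[T] = 0.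
Proof.
move=> TX; have [n [e he]] := fg_generators.
have [M hM] : exists M : 'I_n.+1 -> 'I_n.+1 -> {poly K}, forall k, T (e k) = \sum_l M k l *: e
  l.
  exact: (fin_all_exists (fun k => he (T (e k)))).
pose A := \matrix_(k, l) M k l : 'M[{poly K}]_n.+1.
have evE Q (f : 'I_n.+1 -> {poly K}) :
    ((map_poly (horner_alg (endoX h)) Q).[T] : endo h) (\sum_i f i *: e i) =
    \sum_i f i *: ((map_poly (horner_alg (endoX h)) Q).[T] : endo h) (e i).
  have ev_comm : GRing.comm ((map_poly (horner_alg (endoX h)) Q).[T]) (endoX h).
    by apply/commr_sym/horner_map_comm => //; exact: commr_sym.
  apply: (big_ind2 (fun u w => ((map_poly (horner_alg (endoX h)) Q).[T] : endo h) u = w)).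
  - exact: endo0.
  - by move=> u _ w _ <- <-; rewrite endoD.
  - by move=> i _; apply: comm_endoX.
have key Q k : ((map_poly (horner_alg (endoX h)) Q).[T] : endo h) (e k) =
    \sum_l (horner_mx A Q) k l *: e l.
  elim/poly_ind: Q k => [|Q c IH] k.
    by rewrite !rmorph0 horner0 big1 // => l _; rewrite mxE scale0r.
  rewrite [in RHS]mulrC !(rmorphD, rmorphM) /= horner_mx_X horner_mx_C map_polyX map_polyC
    hornerMXaddC /=.
  under [in RHS]eq_bigr do rewrite mxE scalerDl.
  rewrite big_split /=; congr (_ + _); last first.
    rewrite horner_endoX (bigD1 k) //= !mxE eqxx mulr1n big1 ?addr0 // => l lk.
    by rewrite !mxE eq_sym (negbTE lk) mulr0n scale0r.
  transitivity (((map_poly (horner_alg (endoX h)) Q).[T] : endo h) (T (e k))) => //.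
  rewrite hM evE; under [LHS]eq_bigr do rewrite IH scaler_sumr.
  rewrite exchange_big; apply: eq_bigr => l _; rewrite mxE scaler_suml.
  by apply: eq_bigr => j _; rewrite scalerA !mxE.
exists (char_poly A); first exact: char_poly_monic.
apply: endoP => v; have [f ->] := he v.
rewrite evE big1 // => i _; rewrite key Cayley_Hamilton big1 ?scaler0 // => l _.
by rewrite mxE scale0r.
Qed.

(** The determinant trick of Nakayama's lemma: e = ∂ M e on generators, so det(1 - ∂ M) kills V, yet
    it equals 1 at ∂ = 0. *)
Lemma fg_mulX_not_surjective :
  (forall (f : {poly K}) (v : V), f != 0 -> f *: v = 0 -> v = 0) ->
  ~ forall v : V, exists w, v = 'X *: w.
Proof.
move=> tf sur; have [n [e he]] := fg_generators.
have [M hM] : exists M : 'I_n.+1 -> 'I_n.+1 -> {poly K}, forall k, e k = \sum_l ('X * M k l) *: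
  e l.
  suff Mk k : exists Mk : 'I_n.+1 -> {poly K}, e k = \sum_l ('X * Mk l) *: e l.
    exact: fin_all_exists Mk.
  have [w hw] := sur (e k); have [f hf] := he w.
  by exists f; rewrite hw hf scaler_sumr; apply: eq_bigr => l _; rewrite scalerA.
pose Q := 1%:M - 'X *: \matrix_(k, l) M k l : 'M[{poly K}]_n.+1.
have Qe k : \sum_l Q k l *: e l = 0.
  under eq_bigr do rewrite !mxE scalerBl; rewrite sumrB -hM (bigD1 k) //= eqxx scale1r.
  by rewrite big1 ?addr0 ?subrr // => l lk; rewrite eq_sym (negbTE lk) scale0r.
have dQe j : \det Q *: e j = 0.
  transitivity (\sum_l (\adj Q *m Q) j l *: e l).
    rewrite mul_adj_mx (bigD1 j) //= !mxE eqxx mulr1n big1 ?addr0 // => l lj.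
    by rewrite !mxE eq_sym (negbTE lj) mulr0n scale0r.
  under eq_bigr do rewrite mxE scaler_suml; rewrite exchange_big big1 // => k _.
  by under eq_bigr do rewrite -scalerA; rewrite -scaler_sumr Qe scaler0.
have dQ0 : \det Q != 0.
  apply: contraTneq isT => /(congr1 (horner_eval 0)); rewrite -det_map_mx rmorph0.
  rewrite (_ : map_mx _ Q = 1%:M) ?det1; first by move/eqP; rewrite oner_eq0.
  apply/matrixP => i j; rewrite !mxE /= /horner_eval hornerD hornerN hornerM hornerX mul0r
    subr0.
  by rewrite -polyCMn hornerC.
have [v v0] := h; apply: v0; have [f ->] := he v.
by rewrite big1 // => i _; rewrite (tf _ _ dQ0 (dQe i)) scaler0.
Qed.

End FinitelyGenerated.

(** * Torsion in conformal modules *)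

Section ConformalModules.
Variables (K : numClosedFieldType) (B : lie_conformal_algebra K) (V : conformal_module B).

Lemma actD a a' (v : V) n : act (a + a') v n = act a v n + act a' v n.
Proof. by have := act_linearl 1 a a' v n; rewrite polyC1 !scale1r. Qed.

Lemma act0 (v : V) n : act (0 : B) v n = 0.
Proof. by apply: (addrI (act (0 : B) v n)); rewrite -actD !addr0. Qed.

Lemma actZ (c : K) (a : B) (v : V) n : act (c%:P *: a) v n = c%:P *: act a v n.
Proof. by have := act_linearl c a 0 v n; rewrite act0 !addr0. Qed.

Lemma actDr (a : B) (v w : V) n : act a (v + w) n = act a v n + act a w n.
Proof. by have := act_linearr 1 a v w n; rewrite polyC1 !scale1r. Qed.

Lemma act0r (a : B) n : act a (0 : V) n = 0.
Proof. by apply: (addrI (act a (0 : V) n)); rewrite -actDr !addr0. Qed.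

Lemma actZr (c : K) (a : B) (v : V) n : act a (c%:P *: v) n = c%:P *: act a v n.
Proof. by have := act_linearr c a v 0 n; rewrite act0r !addr0. Qed.

(** From a_λ f(∂)v = f(∂ + λ) a_λ v, by comparing the top powers of λ. *)
Lemma act_leading (a : B) (v : V) N : (forall n, (N < n)%N -> act a v n = 0) ->
  forall d (f : {poly K}), (size f <= d.+1)%N ->
  (forall n, (N + d < n)%N -> act a (f *: v) n = 0) /\
  act a (f *: v) (N + d) = (f`_d)%:P *: act a v N.
Proof.
move=> hN; elim=> [|d IH] f sf.
  rewrite (size1_polyC sf) addn0 coefC eqxx.
  by split=> [n lt|]; rewrite actZr // hN ?scaler0.
have [g [c fE]] : exists g c, f = g * 'X + c%:P.
  by elim/poly_ind: f {sf} => [|g c _]; [exists 0, 0; rewrite mul0r addr0|exists g, c].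
have sg : (size g <= d.+1)%N.
  move: sf; rewrite fE size_MXaddC; case: ifP => [/andP[/eqP -> _]|_]; last by [].
  by rewrite size_poly0.
have [g0 gd] := IH g sg.
have fv n : act a (f *: v) n.+1 = 'X *: act a (g *: v) n.+1 + act a (g *: v) n + c%:P *: act a
  v n.+1.
  by rewrite fE mulrC scalerDl -scalerA actDr actZr act_derivr.
split=> [[//|n] lt|]; last rewrite addnS.
  by rewrite fv !g0 ?hN ?scaler0 ?addr0 //; lia.
rewrite fv g0 ?(hN (N + d).+1) ?scaler0 ?scaler0 ?addr0 ?add0r ?gd; [|lia|lia].
by rewrite fE coefD coefMX coefC /= addr0.
Qed.

Lemma torsion_act (f : {poly K}) (v : V) : f != 0 -> f *: v = 0 ->
  forall (a : B) n, act a v n = 0.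
Proof.
move=> f0 fv a n; apply/eqP; apply: contraT => an.
have [M hM] := act_lpoly a v.
have bd k : act a v k != 0 -> (k <= M)%N.
  by move=> ak; rewrite leqNgt; apply: contra ak => /ltnW/hM ->.
have [N aN hN] := ex_maxnP (ex_intro (fun n => act a v n != 0) n an) bd.
have sf : (size f <= (size f).-1.+1)%N by rewrite leqSpred.
have [|_] := act_leading _ sf (a := a) (v := v) (N := N).
  by move=> k lt; apply/eqP; apply: contraTT lt => /hN; rewrite -leqNgt.
rewrite fv act0r => /esym h; case/eqP: aN.
rewrite -[LHS]scale1r -polyC1 -(mulVf (_ : lead_coef f != 0)) ?lead_coef_eq0 //.
by rewrite polyCM -scalerA h scaler0.
Qed.

Hypothesis V_nontrivial : nontrivial_module V.
Hypothesis V_irreducible : irreducible_module V.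

(** The torsion elements form a submodule on which the algebra acts by zero, so they cannot be all
    of V. *)
Lemma torsion_free (f : {poly K}) (v : V) : f != 0 -> f *: v = 0 -> v = 0.
Proof.
move=> f0 fv; have [_ irr] := V_irreducible.
have [|tor|tor] := irr (fun v => exists2 f : {poly K}, f != 0 & f *: v = 0).
- split=> [|g u w [f1 f10 u0] [f2 f20 w0]|a u n [g g0 gu]].
  + by exists 1; rewrite ?oner_eq0 ?scaler0.
  + exists (f1 * f2); first by rewrite mulf_neq0.
    rewrite scalerDr -[X in _ + X]scalerA w0 scaler0 addr0.
    by rewrite mulrC -scalerA [f1 *: _]scalerA mulrC -scalerA u0 !scaler0.
  + by exists 1; rewrite ?oner_eq0 // (torsion_act g0 gu) scaler0.
- by apply: tor; exists f.
have [a [u [n []]]] := V_nontrivial; have [g g0 gu] := tor u.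
exact: torsion_act g0 gu a n.
Qed.

End ConformalModules.

(** * From λ-brackets to commutators of modes *)

Section Modes.
Variables (K : numClosedFieldType) (B : lie_conformal_algebra K) (V : conformal_module B).
Variable h : exists v : V, v <> 0.
Implicit Types (a b g : B) (v : V).

(* The n-th product operator, n! times the coefficient of λ^n. *)
Definition mode a n : endo h :=
  (n`!)%:R *: (EndoMap (fun c u v => act_linearr c a u v n) : endo h).

Lemma scale_polyC_nat (M : lmodType {poly K}) (v : M) n : v *+ n = (n%:R)%:P *: v.
Proof. by rewrite rmorph_nat scaler_nat. Qed.

Lemma scale_polyCM (M : lmodType {poly K}) (v : M) (c d : K) :
  c%:P *: (d%:P *: v) = (c * d)%:P *: v.
Proof. by rewrite scalerA polyCM. Qed.

(** In [a_λ b]_(λ+μ) the derivation ∂ acts as -(λ + μ), which produces the term with (m + n) u; the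
    factorials absorb the binomial coefficients of the Jacobi identity. *)
Lemma comr_mode a b g (u w beta : K) :
  (forall n, br a b n = nth 0 [:: (u%:P * ('X + beta%:P)) *: g; w%:P *: g] n) ->
  forall m n, comr (mode a m) (mode b n) =
    (m%:R * w - (m + n)%:R * u) *: mode g (m + n).-1 + (u * beta) *: mode g (m + n).
Proof.
move=> hbr m n; apply: endoP => v.
transitivity ((m`!%:R)%:P *: act a ((n`!%:R)%:P *: act b v n) m -
  (n`!%:R)%:P *: act b ((m`!%:R)%:P *: act a v m) n); first by [].
transitivity ((m%:R * w - (m + n)%:R * u)%:P *: ((((m + n).-1)`!%:R)%:P *: act g v (m + n).-1) +
  (u * beta)%:P *: (((m + n)`!%:R)%:P *: act g v (m + n))); last by [].
rewrite !actZr !scale_polyCM [n`!%:R * _]mulrC -scalerBr act_jacobi.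
have br0 k : act (br a b 0) v k =
    (- u)%:P *: Defs.lshift (act g v) k + (u * beta)%:P *: act g v k.
  rewrite hbr /= mulrDr scalerDl actD -scalerA actZ act_derivl scalerN -scaleNr -polyCN.
  by rewrite -polyCM actZ.
have br1 k : act (br a b 1) v k = w%:P *: act g v k by rewrite hbr /= actZ.
rewrite big_ord_recl /= subn0 br0.
have fct i j : (i`! * j`! * 'C(i + j, j) = (i + j)`!)%N.
  by rewrite -(bin_fact (leq_addl i j)) addnK; lia.
have E0 : (m`!%:R * n`!%:R)%:P *: (((- u)%:P *: Defs.lshift (act g v) (m + n) +
      (u * beta)%:P *: act g v (m + n)) *+ 'C(m + n, n)) =
    (- (m + n)%:R * u)%:P *: ((((m + n).-1)`!%:R)%:P *: act g v (m + n).-1) +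
    (u * beta)%:P *: (((m + n)`!%:R)%:P *: act g v (m + n)).
  rewrite scale_polyC_nat scale_polyCM -!natrM fct scalerDr !scale_polyCM.
  congr (_ + _%:P *: _); last by rewrite mulrC.
  case: (m + n)%N => [|k] /=; first by rewrite scaler0 oppr0 !mul0r polyC0 scale0r.
  by congr (_%:P *: _); rewrite factS natrM; ring.
rewrite scalerDr E0 addrAC; congr (_ + _); last by rewrite scale_polyCM.
case: m {E0} => [|m].
  by rewrite big_ord0 scaler0 addr0 mul0r sub0r mulNr scale_polyCM.
rewrite big_ord_recl /= subSS subn0 br1 big1 ?addr0; last first.
  by move=> i _; rewrite hbr /= nth_nil act0 mul0rn.
rewrite scale_polyC_nat !scale_polyCM -scalerDl -polyCD; congr (_%:P *: _).
rewrite -!natrM factS.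
have -> : (m.+1 * m`! * n`! = m.+1 * (m`! * n`!))%N by lia.
rewrite -mulnA fct natrM; ring.
Qed.

Lemma comr_mode0 a b : (forall n, br a b n = 0) -> forall m n, GRing.comm (mode a m) (mode b n).
Proof.
move=> hbr m n; apply: comm_comr; apply: endoP => v.
transitivity ((m`!%:R)%:P *: act a ((n`!%:R)%:P *: act b v n) m -
  (n`!%:R)%:P *: act b ((m`!%:R)%:P *: act a v m) n); first by [].
rewrite !actZr !scale_polyCM [n`!%:R * _]mulrC -scalerBr act_jacobi big1 ?scaler0 //.
by move=> k _; rewrite hbr act0 mul0rn.
Qed.

Lemma comr_modeX a m : comr (mode a m) (endoX h) = m%:R *: mode a m.-1.
Proof.
apply: endoP => v.
transitivity ((m`!%:R)%:P *: act a ('X *: v) m - 'X *: ((m`!%:R)%:P *: act a v m)); first by [].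
transitivity (m%:R%:P *: ((m.-1`!%:R)%:P *: act a v m.-1)); last by [].
rewrite act_derivr scalerDr !scalerA mulrC addrAC subrr add0r.
case: m => [|m] /=; first by rewrite scaler0 mul0r scale0r.
by rewrite factS natrM polyCM.
Qed.

Lemma mode_finite a : locally_finite (endo_module h) (mode a).
Proof.
move=> v; have [N hN] := act_lpoly a (v : V); exists N => n /hN e.
by rewrite -[LHS]/((n`!%:R)%:P *: act a (v : V) n) e scaler0.
Qed.

End Modes.

Section Closure.
Variables (K : numClosedFieldType) (B : lie_conformal_algebra K) (V : conformal_module B).
Variables (I : eqType) (e : I -> B).
Hypothesis e_spanning : spanning e.

(** By sesquilinearity the action of ∂ a is that of a with shifted coefficients and a sign, so the
    spanning elements suffice. *)
Lemma submodule_of_spanning (N : V -> Prop) : N 0 ->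
  (forall (f : {poly K}) u v, N u -> N v -> N (f *: u + v)) ->
  (forall i v n, N v -> N (act (e i) v n)) -> submodule N.
Proof.
move=> N0 ND Ne; split=> // a v n Nv; have [s [f ->]] := e_spanning a.
have ND' u w : N u -> N w -> N (u + w) by move=> Nu Nw; have := ND 1 u w Nu Nw; rewrite scale1r.
have NZ g u : N u -> N (g *: u) by move=> Nu; have := ND g u 0 Nu N0; rewrite addr0.
elim: s n => [|i s IH] n; first by rewrite big_nil act0.
rewrite big_cons actD; apply: (ND') => //; elim/poly_ind: (f i) n {IH} => [|g c IH] n.
  by rewrite scale0r act0.
rewrite scalerDl mulrC -scalerA actD actZ act_derivl; apply: ND'; last exact/NZ/Ne.
by rewrite -scaleN1r; apply: NZ; case: n => [|n] /=.
Qed.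

End Closure.

(** * Freeness of rank one *)

Theorem irreducible_free_rank_one (K : numClosedFieldType) (alpha beta p : K) (p0 : p != 0)
  (B : lie_conformal_algebra K) (L W : nat -> B)
  (hB : is_Balpha_beta_p alpha beta p L W)
  (V : conformal_module B)
  (hfin : finite_module V) (hnontriv : nontrivial_module V)
  (hirr : irreducible_module V) :
  free_of_rank V 1.
Proof.
have [[Bspan _] hLL hLW hWW] := hB; have [h irr] := hirr.
have tf := torsion_free hnontriv hirr.
(* The operator results are applied to the K-linear endomorphisms of V, with x = ∂. *)
have [||||||||||||v v0 hv] := @cyclic_over_x K (endo h) (endo_module h) p alpha beta (endoX h)
  (fun i => mode h (L i)) (fun i => mode h (W i)) p0.
- move=> i j m n; rewrite (@comr_mode _ _ V h _ _ (L (i + j)%N) (i%:R + p) (i%:R + j%:R + p *+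
  2) 0).
    by rewrite mulr0 scale0r addr0 natrD; congr (_ *: _); ring.
  by move=> k; rewrite hLL polyC0 addr0.
- move=> i j m n; rewrite (@comr_mode _ _ V h _ _ (W (i + j)%N) (i%:R + p) (i%:R + j%:R +
  alpha) beta) //.
  by congr (_ *: _ + _); rewrite natrD; ring.
- by move=> i j; apply: comr_mode0.
- by move=> i m; exact: comr_modeX.
- by move=> i m; exact: comr_modeX.
- by move=> T; exact: endoX_integral.
- by move=> f u f0; rewrite -[_ *: u]/((horner_alg (endoX h) f : endo h) (u : V)) horner_endoX;
  exact: tf.
- exact: fg_mulX_not_surjective.
- by move=> a a0; apply: endoP => u; exact: a0.
- by move=> i; exact: mode_finite.
- by move=> i; exact: mode_finite.
- move=> N N0 ND [Nx NL NW].
  have NK (k : K) u : N u -> N (k%:P *: u : V).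
    by move=> Nu; have := ND k u 0 Nu N0; rewrite addr0.
  have ND1 u w : N u -> N w -> N (u + w).
    by move=> Nu Nw; have := ND 1 u w Nu Nw; rewrite scale1r scale1r.
  have Nf (f : {poly K}) u : N u -> N (f *: (u : V)).
    elim/poly_ind: f u => [|f k IH] u Nu; first by rewrite scale0r.
    by rewrite scalerDl -scalerA; apply: ND1; [apply/IH/Nx|exact: NK].
  (* As n! is invertible, stability under the modes is stability under the λ-coefficients. *)
  have Nmode a n u : N (mode h a n *: u) -> N (act a (u : V) n).
    move/(NK (n`!%:R)^-1); rewrite -[_ *: u]/((n`!%:R)%:P *: act a (u : V) n).
    by rewrite scale_polyCM mulVf ?polyC1 ?scale1r // pnatr_eq0 -lt0n fact_gt0.
  apply: irr; apply: (submodule_of_spanning Bspan) => // [f u w Nu Nw|[i|i] u n Nu].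
  - by apply: ND1 => //; exact: Nf.
  - by apply: Nmode; exact: NL.
  - by apply: Nmode; exact: NW.
(* The vector v generates V, and its independence is torsion-freeness. *)
exists (fun _ => v : V); split.
  move=> w; have [f ->] := hv w; exists [:: ord0], (fun _ => f).
  by rewrite big_seq1 -horner_endoX.
move=> s f us; case: s us => [|i [|j s]] //=; last first.
  by rewrite (ord1 i) (ord1 j) inE eqxx.
move=> _; rewrite big_seq1 => fv k; rewrite inE => /eqP ->.
by apply/eqP; apply: contraT => f0; case: v0; exact: tf f0 fv.
Qed.

Theorem lemma4p6 (R : realType) (alpha beta p : R[i]) (hp : p != 0)
  (B : lie_conformal_algebra R[i]) (L W : nat -> B)
  (hB : is_Balpha_beta_p alpha beta p L W)
  (V : conformal_module B)
  (hfin : finite_module V) (hnontriv : nontrivial_module V)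
  (hirr : irreducible_module V) :
  free_of_rank V 1.
Proof.
exact: (@irreducible_free_rank_one R[i] alpha beta p hp B L W hB V hfin hnontriv hirr).
Qed.
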